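(* Let $(\boldsymbol{\hat\omega},\mathbf A)\in\hat\Omega\times\mathcal B^{\mathbb C}$ with $\mathbf A=[A\,|\,B]=[(A_1,A_2)\,|\,(B_1,B_2)]$, where $A_j,B_j$ are $2d\times d$ matrices. Let $\boldsymbol\tau$ be the discrete Sturm-Liouville equation obtained from $\boldsymbol{\hat\omega}$ and let $\mathbf C=[(A_1,A_2)\,|\,(B_1-A_1,B_2)]$. Then the eigenvalues of $(\boldsymbol{\hat\omega},\mathbf A)$, including multiplicities, are the same as those of $(\boldsymbol\tau,\mathbf A)=(\boldsymbol\tau,\mathbf C)$, and $$\sharp_1(\sigma(\boldsymbol{\hat\omega},\mathbf A))=\sharp_1(\sigma(\boldsymbol\tau,\mathbf A))=\sharp_1(\sigma(\boldsymbol\tau,\mathbf C))=(N-1)d+\operatorname{rank}(B).$$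
   Context: Let $d\ge1$, $N>1$, and fix a partition $a=a_0<b_0<a_1<b_1<\cdots<a_N<b_N=b$. $\hat\Omega$ is the set of triples $\boldsymbol{\hat\omega}=(\hat P^{-1},\hat Q,\hat W)$ of integrable Hermitian $d\times d$ matrix-valued functions on $(a,b)$ such that: $\hat P^{-1}\equiv0$ on $[a_i,b_i]$ and $\hat W_i:=\int_{a_i}^{b_i}\hat W(s)\,ds$ is positive definite for $0\le i\le N$; and $\hat Q\equiv\hat W\equiv0$ on $[b_{j-1},a_j]$ and $\hat P_j^{-1}:=\int_{b_{j-1}}^{a_j}\hat P^{-1}(s)\,ds$ is invertible (with inverse denoted $\hat P_j$) for $1\le j\le N$. Put $\hat Q_i=\int_{a_i}^{b_i}\hat Q(s)\,ds$ for $0\le i\le N$ and $\hat P_0=\hat P_{N+1}=I_d$. $\mathcal B^{\mathbb C}$ is the space of self-adjoint boundary conditions: the quotient of $\{(A,B)\in\mathcal M_{2d,4d}(\mathbb C):\operatorname{rank}(A,B)=2d,\ AB^*=BA^*\}$ ($A,B$ being $2d\times2d$) by left multiplication by $\mathrm{GL}(2d,\mathbb C)$. The class of $(A,B)$ is written $[A\,|\,B]$. The problem of Atkinson type $(\boldsymbol{\hat\omega},\mathbf A)$ is $$-(\hat Py')'+\hat Qy=\lambda\hat Wy\ \text{ on }(a,b),\qquad A\begin{pmatrix}-y(a)\\ y(b)\end{pmatrix}+B\begin{pmatrix}(\hat Py')(a)\\ (\hat Py')(b)\end{pmatrix}=0,$$ where the equation is understood as the first-order system $u'=\hat P^{-1}v$,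 $v'=(\hat Q-\lambda\hat W)u$ with $u=y$, $v=\hat Py'$. The associated discrete equation $\boldsymbol\tau=(\{\hat P_j^{-1}\}_{j=0}^{N+1},\{\hat Q_i\}_{i=0}^N,\{\hat W_i\}_{i=0}^N)$ is $$-\nabla(\hat P_{i+1}\Delta u_i)+\hat Q_iu_i=\lambda\hat W_iu_i,\quad 0\le i\le N,$$ for $\{u_i\}_{i=-1}^{N+1}$, $u_i\in\mathbb C^d$, where $\Delta u_i=u_{i+1}-u_i$ and $\nabla(\hat P_{i+1}\Delta u_i)=\hat P_{i+1}\Delta u_i-\hat P_i\Delta u_{i-1}$. The problem $(\boldsymbol\tau,\mathbf A)$ means this equation with the boundary condition $$A\begin{pmatrix}-u_0\\ u_N\end{pmatrix}+B\begin{pmatrix}\Delta u_{-1}\\ \Delta u_N\end{pmatrix}=0.$$ The problem $(\boldsymbol\tau,\mathbf C)$ means this equation with the (equivalent) boundary condition $$(A_1,A_2)\begin{pmatrix}-u_{-1}\\ u_N\end{pmatrix}+(B_1-A_1,B_2)\begin{pmatrix}\Delta u_{-1}\\ \Delta u_N\end{pmatrix}=0.$$ For all these problems, $\lambda$ is an eigenvalue if there is a nontrivial solution, its multiplicity is the number of linearly independent eigenfunctions, and $\sharp_1(\sigma(\cdot))$ is the number of eigenvalues counted with multiplicity. *)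

(* Defs.v *)
From HB Require Import structures.
From mathcomp Require Import all_boot all_order all_algebra.
From mathcomp Require Import sesquilinear spectral.
From mathcomp Require Import all_classical all_reals all_analysis.
From mathcomp Require Import complex.

Set Implicit Arguments.
Unset Strict Implicit.
Unset Printing Implicit Defensive.

Import Order.TTheory GRing.Theory Num.Theory.
Import numFieldNormedType.Exports.

Local Open Scope classical_set_scope.
Local Open Scope ring_scope.
Local Open Scope sesquilinear_scope.
Local Open Scope complex_scope.

Definition entrywise (R : realType) (P : (R -> R) -> Prop) (m n : nat)
    (F : R -> 'M[R[i]]_(m, n)) : Prop :=
  forall i j, P (fun x => complex.Re (F x i j)) /\
              P (fun x => complex.Im (F x i j)).

Definition mx_integrable (R : realType) (D : set R) (m n : nat)
    (F : R -> 'M[R[i]]_(m, n)) : Prop :=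
  entrywise (fun f => lebesgue_measure.-integrable D (EFin \o f)) F.

Definition mx_integral (R : realType) (D : set R) (m n : nat)
    (F : R -> 'M[R[i]]_(m, n)) : 'M[R[i]]_(m, n) :=
  \matrix_(i, j)
    (Rintegral lebesgue_measure D (fun x => complex.Re (F x i j)) +i*
     Rintegral lebesgue_measure D (fun x => complex.Im (F x i j))).

Definition is_mx_derive (R : realType) (m n : nat)
    (F : R -> 'M[R[i]]_(m, n)) (x : R) (L : 'M[R[i]]_(m, n)) : Prop :=
  forall i j,
    is_derive x 1 (fun t => complex.Re (F t i j)) (complex.Re (L i j)) /\
    is_derive x 1 (fun t => complex.Im (F t i j)) (complex.Im (L i j)).

(* Only the values of [f] on [a, b] matter. *)
Definition absolutely_continuous (R : realType) (a b : R) (f : R -> R) : Prop :=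
  forall e : R, 0 < e -> exists2 dlt : R, 0 < dlt &
    forall (n : nat) (s t : 'I_n -> R),
      (forall i, a <= s i /\ s i <= t i /\ t i <= b) ->
      (forall i j, i != j -> t i <= s j \/ t j <= s i) ->
      \sum_i (t i - s i) < dlt ->
      \sum_i `|f (t i) - f (s i)| < e.

Definition mx_absolutely_continuous (R : realType) (a b : R) (m n : nat)
    (F : R -> 'M[R[i]]_(m, n)) : Prop :=
  entrywise (absolutely_continuous a b) F.

Definition posdefmx (R : realType) (d : nat) (M : 'M[R[i]]_d) : Prop :=
  M \is hermsymmx /\
  forall x : 'cV[R[i]]_d, x != 0 -> 0 < (x ^t* *m M *m x) 0 0.

(* [sol l] is the set of solutions for the spectral parameter [l], among
   C^d-valued functions on [dom]; functions are total on [T], but values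
   outside [dom] are disregarded (see [nontrivial], [lin_indep]). *)
Record eigenproblem (R : realType) (d : nat) (T : Type) := EigenProblem {
  dom : set T;
  sol : R[i] -> set (T -> 'cV[R[i]]_d) }.

Definition nontrivial (R : realType) (d : nat) (T : Type) (D : set T)
    (u : T -> 'cV[R[i]]_d) : Prop :=
  exists2 x, D x & u x != 0.

Definition lin_indep (R : realType) (d : nat) (T : Type) (D : set T) (k : nat)
    (f : 'I_k -> T -> 'cV[R[i]]_d) : Prop :=
  forall c : 'I_k -> R[i],
    (forall x, D x -> \sum_j c j *: f j x = 0) -> forall j, c j = 0.

Definition spectrum (R : realType) (d : nat) (T : Type)
    (p : eigenproblem R d T) : set R[i] :=
  [set l | exists2 u, sol p l u & nontrivial (dom p) u].

(* The largest number (possibly +oo) of linearly independent solutions. *)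
Definition multiplicity (R : realType) (d : nat) (T : Type)
    (p : eigenproblem R d T) (l : R[i]) : \bar R :=
  ereal_sup [set (k%:R)%:E | k in
    [set k | exists f : 'I_k -> T -> 'cV[R[i]]_d,
       (forall j, sol p l (f j)) /\ lin_indep (dom p) f]].

Definition sharp1 (R : realType) (d : nat) (T : Type)
    (p : eigenproblem R d T) : \bar R :=
  (\esum_(l in spectrum p) multiplicity p l)%E.

(* [A | B], as the orbit of (A, B) under left multiplication by GL(2d, C). *)
Definition bc_class (R : realType) (d : nat) (A B : 'M[R[i]]_(d + d)) :
    set ('M[R[i]]_(d + d) * 'M[R[i]]_(d + d)) :=
  [set (G *m A, G *m B) | G in [set G | G \in unitmx]].

Definition BC (R : realType) (d : nat) :
    set (set ('M[R[i]]_(d + d) * 'M[R[i]]_(d + d))) :=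
  [set X | exists A B, [/\ \rank (row_mx A B) = (d + d)%N,
                           A *m B ^t* = B *m A ^t* & X = bc_class A B]].

Definition bc_holds (R : realType) (d : nat)
    (X : set ('M[R[i]]_(d + d) * 'M[R[i]]_(d + d)))
    (p q : 'cV[R[i]]_(d + d)) : Prop :=
  forall A B, X (A, B) -> A *m p + B *m q = 0.

Lemma bc_holdsP (R : realType) (d : nat) (A B : 'M[R[i]]_(d + d))
    (p q : 'cV[R[i]]_(d + d)) :
  bc_holds (bc_class A B) p q <-> A *m p + B *m q = 0.
Proof.
split=> [h|h A' B' [G _ [<- <-]]].
- by apply: h; exists 1%:M; [exact: unitmx1 | rewrite !mul1mx].
- by rewrite -!mulmxA -mulmxDr h mulmx0.
Qed.

Lemma BC_classP (R : realType) (d : nat) (A B : 'M[R[i]]_(d + d)) :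
  BC (bc_class A B) <->
  \rank (row_mx A B) = (d + d)%N /\ A *m B ^t* = B *m A ^t*.
Proof.
split=> [[A' [B' [rk sa eqX]]]|[rk sa]]; last by exists A, B.
have : bc_class A' B' (A, B).
  by rewrite -eqX; exists 1%:M; [exact: unitmx1 | rewrite !mul1mx].
case=> G /= Gu [<- <-]; split.
  have Gf : row_full G by rewrite row_full_unit.
  by rewrite -mul_mx_row (eqmxMfull _ Gf).
by rewrite !trmx_mul !map_mxM !mulmxA -(mulmxA G A') -(mulmxA G B') sa.
Qed.

(* The class [(A1, A2) | (B1 - A1, B2)] is again a self-adjoint boundary
   condition. *)
Lemma BC_shift (R : realType) (d : nat) (A1 A2 B1 B2 : 'M[R[i]]_(d + d, d)) :
  BC (bc_class (row_mx A1 A2) (row_mx B1 B2)) ->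
  BC (bc_class (row_mx A1 A2) (row_mx (B1 - A1) B2)).
Proof.
move=> /BC_classP[rk sa]; apply/BC_classP.
have E : row_mx (B1 - A1) B2 =
    row_mx B1 B2 - row_mx A1 A2 *m block_mx 1%:M 0 0 0.
  rewrite mul_row_block !mulmx0 mulmx1 !addr0.
  by rewrite opp_row_mx add_row_mx oppr0 addr0.
set A := row_mx A1 A2 in rk sa E *; set B := row_mx B1 B2 in rk sa E.
rewrite E; set K := block_mx _ _ _ _.
have KH : K ^t* = K.
  by rewrite /K tr_block_mx map_block_mx !trmx0 !map_mx0 trmx1 map_mx1.
split; last first.
  rewrite linearB/= map_mxB mulmxBr mulmxBl sa; congr (_ - _).
  by rewrite trmx_mul map_mxM KH mulmxA.
have -> : row_mx A (B - A *m K) = row_mx A B *m block_mx 1%:M (- K) 0 1%:M.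
  by rewrite [RHS]mul_row_block !mulmx1 mulmx0 addr0 mulmxN addrC.
rewrite mxrankMfree// row_free_unit unitmxE.
by rewrite det_ublock !det1 mulr1 unitr1.
Qed.

Definition atkinson_partition (R : realType) (N : nat) (a b : R) (a_ b_ : nat -> R) :
    Prop :=
  [/\ a_ 0%N = a, b_ N = b,
      forall i, (i <= N)%N -> a_ i < b_ i &
      forall i, (i < N)%N -> b_ i < a_ i.+1].

Record sl_coeffs (R : realType) (d : nat) := SLCoeffs {
  slPinv : R -> 'M[R[i]]_d;
  slQ : R -> 'M[R[i]]_d;
  slW : R -> 'M[R[i]]_d }.

Definition hermitian_integrable (R : realType) (d : nat) (a b : R)
    (F : R -> 'M[R[i]]_d) : Prop :=
  mx_integrable `]a, b[ F /\ forall x, a < x < b -> F x \is hermsymmx.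

(* [c, e] is intersected with (a, b), where the coefficients live. *)
Definition vanishes_on (R : realType) (d : nat) (a b c e : R)
    (F : R -> 'M[R[i]]_d) : Prop :=
  forall x, a < x < b -> c <= x <= e -> F x = 0.

Definition OmegaHat (R : realType) (d N : nat) (a b : R) (a_ b_ : nat -> R) :
    set (sl_coeffs R d) :=
  [set w |
    [/\ hermitian_integrable a b (slPinv w),
        hermitian_integrable a b (slQ w) &
        hermitian_integrable a b (slW w)] /\
    (forall i, (i <= N)%N ->
        vanishes_on a b (a_ i) (b_ i) (slPinv w) /\
        posdefmx (mx_integral `[a_ i, b_ i] (slW w))) /\
    (forall j, (1 <= j <= N)%N ->
        [/\ vanishes_on a b (b_ j.-1) (a_ j) (slQ w),
            vanishes_on a b (b_ j.-1) (a_ j) (slW w) &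
            mx_integral `[b_ j.-1, a_ j] (slPinv w) \in unitmx])].

(* The first-order system u' = P^-1 v, v' = (Q - l W) u on (a, b), in the sense
   of Caratheodory. *)
Definition sl_system (R : realType) (d : nat) (a b : R) (w : sl_coeffs R d)
    (l : R[i]) (u v : R -> 'cV[R[i]]_d) : Prop :=
  [/\ mx_absolutely_continuous a b u,
      mx_absolutely_continuous a b v &
      {ae lebesgue_measure, forall x, a < x < b ->
         is_mx_derive u x (slPinv w x *m v x) /\
         is_mx_derive v x ((slQ w x - l *: slW w x) *m u x)}].

(* A solution is the function y = u; v plays the role of P y'. *)
Definition sl_problem (R : realType) (d : nat) (a b : R) (w : sl_coeffs R d)
    (X : set ('M[R[i]]_(d + d) * 'M[R[i]]_(d + d))) : eigenproblem R d R :=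
  EigenProblem `[a, b]
    (fun l => [set y | exists2 v, sl_system a b w l y v &
       bc_holds X (col_mx (- y a) (y b)) (col_mx (v a) (v b))]).

(* [dPinv] is used at indices 0, .., N + 1, and [dQ], [dW] at 0, .., N. *)
Record discrete_eq (R : realType) (d : nat) := DiscreteEq {
  dPinv : nat -> 'M[R[i]]_d;
  dQ : nat -> 'M[R[i]]_d;
  dW : nat -> 'M[R[i]]_d }.

Definition discrete_of (R : realType) (d N : nat) (a_ b_ : nat -> R)
    (w : sl_coeffs R d) : discrete_eq R d :=
  DiscreteEq
    (fun j => if (1 <= j <= N)%N
              then mx_integral `[b_ j.-1, a_ j] (slPinv w) else 1%:M)
    (fun i => mx_integral `[a_ i, b_ i] (slQ w))
    (fun i => mx_integral `[a_ i, b_ i] (slW w)).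

Definition Delta (R : realType) (d : nat) (u : int -> 'cV[R[i]]_d) (i : int) :
    'cV[R[i]]_d :=
  u (i + 1) - u i.

Definition discrete_solution (R : realType) (d N : nat) (tau : discrete_eq R d)
    (l : R[i]) (u : int -> 'cV[R[i]]_d) : Prop :=
  let P j := invmx (dPinv tau j) in
  forall i : nat, (i <= N)%N ->
    - (P i.+1 *m Delta u i%:Z - P i *m Delta u (i%:Z - 1))
      + dQ tau i *m u i%:Z = l *: (dW tau i *m u i%:Z).

Definition discrete_dom (N : nat) : set int :=
  [set i : int | (-1 <= i <= N%:Z + 1)%R].

(* Two conventions: the boundary vector is (-u_0, u_N) in [discrete_problem0]
   and (-u_{-1}, u_N) in [discrete_problem1]. *)
Definition discrete_problem0 (R : realType) (d N : nat) (tau : discrete_eq R d)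
    (X : set ('M[R[i]]_(d + d) * 'M[R[i]]_(d + d))) : eigenproblem R d int :=
  EigenProblem (discrete_dom N)
    (fun l => [set u | discrete_solution N tau l u /\
       bc_holds X (col_mx (- u 0) (u N%:Z))
                  (col_mx (Delta u (-1)) (Delta u N%:Z))]).

Definition discrete_problem1 (R : realType) (d N : nat) (tau : discrete_eq R d)
    (X : set ('M[R[i]]_(d + d) * 'M[R[i]]_(d + d))) : eigenproblem R d int :=
  EigenProblem (discrete_dom N)
    (fun l => [set u | discrete_solution N tau l u /\
       bc_holds X (col_mx (- u (-1)) (u N%:Z))
                  (col_mx (Delta u (-1)) (Delta u N%:Z))]).

(* Main.v *)
Require Import Defs.
From mathcomp Require Import all_boot all_order all_algebra.
From mathcomp Require Import sesquilinear spectral.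
From mathcomp Require Import all_classical all_reals all_analysis.
From mathcomp Require Import complex ring lra.
Set Implicit Arguments.
Unset Strict Implicit.
Unset Printing Implicit Defensive.
Import Order.TTheory GRing.Theory Num.Theory.
Import numFieldNormedType.Exports.

(** In a problem of Atkinson type only one of the two equations of the system
    [u' = P^-1 v], [v' = (Q - l W) u] is active at a time. On a cell
    [[a_i, b_i]] the function [u] is constant, equal to [u_i], and [v] grows by
    [(Q_i - l W_i) u_i]; on a gap [[b_(j-1), a_j]] the function [v] is constant,
    equal to [v_j], and [u] grows by [P_j^-1 v_j]. The numbers [u_i], [v_j] obey
    the discrete equation with [v_j = P_j (u_j - u_(j-1))], and they determine
    the solution, so for every [l] the two problems have isomorphic solution
    spaces ([indep_sizes_sl]). Multiplicities and spectra depend only on which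
    numbers of independent solutions exist, whence the comparison of the
    continuous and the discrete problem. The systems are meant in the sense of
    Caratheodory; what is needed about them is the fundamental theorem of
    calculus for absolutely continuous functions, which follows from Lebesgue's
    differentiation theorem and from the fact that an absolutely continuous
    function with zero derivative almost everywhere is constant
    ([absolutely_continuous_derive0]).

    To count the eigenvalues of the discrete problem, parametrize the
    self-adjoint boundary condition [A p + B q = 0], where [p = (-u_0, u_N)] and
    [q = (v_0, v_(N+1))], by [p = B^* z], [q = - A^* z]. The sequences
    [(u_0, ..., u_N)] whose [p] lies in the range of [B^*] form a space of
    dimension [n = (N - 1) d + rank B]. Testing the discrete equation against
    this space and summing by parts, the problem becomes [H c = l G c] with
    [H], [G] Hermitian of size [n]: the boundary terms contribute
    [Z^* (B A^* ) Z] to [H], where [Z] maps a sequence to its parameter [z], and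
    this is Hermitian because [A B^* = B A^*]. The matrix [G] is positive
    definite because all [W_i] are, so the pencil can be diagonalized by
    congruence and has exactly [n] eigenvalues with multiplicity
    ([discrete_diagonalizable], [sharp1_diag]). *)

(** * Linearly independent solutions *)

Section Solutions.
Local Open Scope classical_set_scope.
Local Open Scope ring_scope.
Local Open Scope sesquilinear_scope.
Local Open Scope complex_scope.

(** The possible sizes of families of independent solutions. The multiplicity is
    by definition the supremum of this set, and [l] is an eigenvalue exactly when
    it contains 1, so that two problems with the same [indep_sizes] have the same
    eigenvalues and multiplicities. *)
Definition indep_sizes (R : realType) (d : nat) (T : Type)
    (p : eigenproblem R d T) (l : R[i]) : set nat :=
  [set k | exists f : 'I_k -> T -> 'cV[R[i]]_d,
     (forall j, sol p l (f j)) /\ lin_indep (dom p) f].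

Lemma spectrumE (R : realType) (d : nat) (T : Type)
    (p : eigenproblem R d T) (l : R[i]) :
  spectrum p l <-> indep_sizes p l 1%N.
Proof.
split=> [[u su [x dx ux]]|[f [sf indf]]].
  exists (fun=> u); split=> // c /(_ x dx).
  rewrite big_ord1 => /eqP; rewrite scaler_eq0 (negbTE ux) orbF => /eqP c0 j.
  by rewrite ord1.
exists (f ord0); first exact: sf.
apply: contrapT => triv.
suff /(_ ord0)/eqP : forall j : 'I_1, (fun=> 1) j = 0 :> R[i] by rewrite oner_eq0.
apply: indf => x dx; rewrite big_ord1 scale1r.
by apply/eqP/negPn/negP => fx; apply: triv; exists x.
Qed.

(** An isomorphism of solution spaces, given by a linear operator [L] between all
    functions on the two domains. Functions count only through their values on
    the domains, hence the pointwise form of surjectivity and injectivity. *)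
Lemma indep_sizes_inj (R : realType) (d1 d2 : nat) (T1 T2 : Type)
    (p1 : eigenproblem R d1 T1) (p2 : eigenproblem R d2 T2) (l : R[i])
    (L : (T2 -> 'cV[R[i]]_d2) -> T1 -> 'cV[R[i]]_d1) :
  linear L ->
  sol p2 l 0 ->
  (forall c u v, sol p2 l u -> sol p2 l v -> sol p2 l (c *: u + v)) ->
  (forall u, sol p1 l u ->
     exists2 v, sol p2 l v & forall x, dom p1 x -> u x = L v x) ->
  (forall v, sol p2 l v -> sol p1 l (L v)) ->
  (forall v, sol p2 l v ->
     (forall x, dom p1 x -> L v x = 0) <-> (forall x, dom p2 x -> v x = 0)) ->
  indep_sizes p1 l = indep_sizes p2 l.
Proof.
move=> Ll s0 sD surj stab inj.
have L0 : L 0 = 0.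
  by have := Ll (-1) 0 0; rewrite scaleN1r oppr0 addr0 => ->; rewrite scaleN1r addNr.
have comb k (c : 'I_k -> R[i]) (g : 'I_k -> T2 -> 'cV[R[i]]_d2) :
    (forall j, sol p2 l (g j)) ->
    (forall x, dom p1 x -> \sum_j c j *: L (g j) x = 0) <->
    (forall x, dom p2 x -> \sum_j c j *: g j x = 0).
  move=> sg; set S := \sum_j c j *: g j.
  have [sS LS] : sol p2 l S /\ L S = \sum_j c j *: L (g j).
    rewrite /S; apply: (big_ind2 (fun a b => sol p2 l a /\ L a = b)).
    - by split.
    - move=> a _ b _ [sa <-] [sb <-]; have := sD 1 _ _ sa sb.
      by have := Ll 1 a b; rewrite !scale1r.
    - move=> j _; have := sD (c j) _ _ (sg j) s0.
      by have := Ll (c j) (g j) 0; rewrite L0 !addr0.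
  have := inj S sS; rewrite LS => h.
  have SE x : S x = \sum_j c j *: g j x by rewrite /S fct_sumE.
  have LE x : (\sum_j c j *: L (g j)) x = \sum_j c j *: L (g j) x.
    by rewrite fct_sumE.
  split=> hh x dx; first by rewrite -SE; apply: h.1 => // y dy; rewrite LE hh.
  by rewrite -LE; apply: h.2 => // y dy; rewrite SE hh.
apply/seteqP; split=> k [f [sf indf]].
  have /choice[g gP] (j : 'I_k) : exists v, sol p2 l v /\
      forall x, dom p1 x -> f j x = L v x.
    by have [v sv fv] := surj _ (sf j); exists v.
  exists g; split=> [j|c c0]; first by case: (gP j).
  apply: indf => x dx.
  rewrite (eq_bigr (fun j => c j *: L (g j) x)).
    by move: x dx; apply/comb => // j; case: (gP j).
  by move=> j _; case: (gP j) => _ ->.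
exists (fun j => L (f j)); split=> [j|c c0]; first exact: stab.
by apply: indf; apply/comb.
Qed.

(** The one-point domain turns vectors into functions, so that a pencil can be
    compared with the other problems. *)
Definition pencil (R : realType) (n : nat) (H G : 'M[R[i]]_n) :
    eigenproblem R n unit :=
  EigenProblem setT (fun l => [set c | H *m c tt = l *: (G *m c tt)]).

Lemma adjmxM (C : numClosedFieldType) m n p (A : 'M[C]_(m, n)) (B : 'M[C]_(n, p)) :
  (A *m B)^t* = B^t* *m A^t*.
Proof. by rewrite trmx_mul map_mxM. Qed.

Lemma hermmxP (C : numClosedFieldType) n (A : 'M[C]_n) :
  reflect (A^t* = A) (A \is hermsymmx).
Proof.
apply: (iffP idP) => [/is_hermitianmxP|]; first by rewrite scale1r => <-.
by move=> hA; apply/is_hermitianmxP; rewrite scale1r.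
Qed.

(** First reduce [G] to the identity by its spectral decomposition and the square
    roots of its eigenvalues, then diagonalize the transformed [H] unitarily. *)
Lemma simultaneous_diagonalization (C : numClosedFieldType) n (H G : 'M[C]_n) :
  H^t* = H -> G^t* = G ->
  (forall x : 'cV[C]_n, x != 0 -> 0 < (x^t* *m G *m x) 0 0) ->
  exists2 X, X \in unitmx & exists D : 'rV[C]_n,
    X^t* *m G *m X = 1%:M /\ X^t* *m H *m X = diag_mx D.
Proof.
move=> hH /hermmxP hG posG.
pose P := spectralmx G; pose D := spectral_diag G.
have Pu : P \is unitarymx by exact: spectral_unitarymx.
have PP : P *m P^t* = 1%:M by exact/unitarymxP.
have GE : G = P^t* *m diag_mx D *m P.
  by rewrite -invmx_unitary//; exact/orthomx_spectralP/hermitian_normalmx.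
have Dpos i : 0 < D 0 i.
  pose x := P^t* *m delta_mx i (0 : 'I_1).
  have x0 : x != 0.
    apply/negP => /eqP/(congr1 (mulmx P)); rewrite mulmxA PP mul1mx mulmx0.
    by move/matrixP/(_ i 0); rewrite !mxE !eqxx => /eqP; rewrite oner_eq0.
  have := posG x x0; rewrite GE /x adjmxM trmxCK !mulmxA.
  rewrite -(mulmxA _ P) PP mulmx1 -(mulmxA _ P) PP mulmx1.
  rewrite trmx_delta map_delta_mx -rowE -colE !mxE eqxx.
  by rewrite mulr1n.
(* [X0] turns [G] into the identity. *)
pose S := diag_mx (\row_i (sqrtC (D 0 i))^-1).
have hS : S^t* = S.
  rewrite /S tr_diag_mx map_diag_mx; congr diag_mx; apply/rowP => i.
  by rewrite !mxE /= geC0_conj// invr_ge0 sqrtC_ge0 ltW.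
pose X0 := P^t* *m S.
have X0G : X0^t* *m G *m X0 = 1%:M.
  rewrite /X0 adjmxM trmxCK hS GE !mulmxA -(mulmxA _ P) PP mulmx1.
  rewrite -(mulmxA _ P) PP mulmx1 /S !mulmx_diag -diag_const_mx; congr diag_mx.
  apply/rowP => i; rewrite !mxE mulrAC -expr2 exprVn sqrtCK mulVf//.
  by rewrite gt_eqF.
clearbody X0; pose H0 := X0^t* *m H *m X0.
have hH0 : H0 \is hermsymmx.
  by apply/hermmxP; rewrite /H0 !adjmxM trmxCK hH mulmxA.
pose V := spectralmx H0.
have Vu : V \is unitarymx by exact: spectral_unitarymx.
have VV : V *m V^t* = 1%:M by exact/unitarymxP.
have H0E : H0 = V^t* *m diag_mx (spectral_diag H0) *m V.
  by rewrite -invmx_unitary//; exact/orthomx_spectralP/hermitian_normalmx.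
have XG : (X0 *m V^t*)^t* *m G *m (X0 *m V^t*) = 1%:M.
  rewrite adjmxM trmxCK !mulmxA -2!(mulmxA V) X0G.
  by rewrite mulmx1 VV.
exists (X0 *m V^t*); first by case/mulmx1_unit : XG.
exists (spectral_diag H0); split=> //.
rewrite adjmxM trmxCK !mulmxA -2!(mulmxA V) -/H0.
by rewrite {1}H0E !mulmxA VV mul1mx -mulmxA VV mulmx1.
Qed.

Definition diag_mult (C : eqType) n (D : 'rV[C]_n) (l : C) : nat :=
  #|[pred i | D 0 i == l]|.

Lemma indep_sizes_pencil (R : realType) n (H G X : 'M[R[i]]_n) (D : 'rV[R[i]]_n) l :
  X \in unitmx -> X^t* *m G *m X = 1%:M -> X^t* *m H *m X = diag_mx D ->
  indep_sizes (pencil H G) l = [set k | (k <= diag_mult D l)%N].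
Proof.
move=> Xu XG XH.
have Xau : X^t* \in unitmx by rewrite map_unitmx unitmx_tr.
(* In the coordinates [c = X e] the pencil is diagonal. *)
have solE (c : 'cV_n) : H *m (X *m c) = l *: (G *m (X *m c)) <->
    (forall i, D 0 i != l -> c i 0 = 0).
  have -> : H *m (X *m c) = l *: (G *m (X *m c)) <-> diag_mx D *m c = l *: c.
    split=> [E|E].
      by rewrite -XH -!mulmxA E -scalemxAr !mulmxA XG mul1mx.
    apply: (can_inj (mulKmx Xau)); rewrite -scalemxAr !mulmxA XG XH E.
    by rewrite mul1mx.
  split=> [/matrixP E i Dl|E].
    have := E i 0; rewrite mul_diag_mx !mxE => /eqP; rewrite -subr_eq0 -mulrBl.
    by rewrite mulf_eq0 subr_eq0 (negbTE Dl) => /eqP.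
  apply/matrixP => i j; rewrite ord1 mul_diag_mx !mxE.
  have [->//|Dl] := eqVneq (D 0 i) l.
  by rewrite E// !mulr0.
rewrite /diag_mult; set I := [pred i | _]; apply/seteqP; split=> k /=.
  move=> [f [sf indf]].
  (* The rows of [M] are the solutions in diagonal coordinates; they vanish
     outside the columns of [I], so that the rank [k] is at most [#|I|]. *)
  pose M : 'M[R[i]]_(k, n) := \matrix_(j, i) (invmx X *m f j tt) i 0.
  have Mz j i : D 0 i != l -> M j i = 0.
    move=> Dl; rewrite mxE; move: i Dl; apply/solE; rewrite mulKVmx//; exact: sf.
  have freeM : row_free M.
    apply: inj_row_free => v /matrixP vM; apply/rowP => j; rewrite [RHS]mxE.
    apply: (indf (fun j => v 0 j)) => -[] _.
    apply: (can_inj (mulKmx (_ : invmx X \in unitmx))); first by rewrite unitmx_inv.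
    rewrite mulmx0 mulmx_sumr; apply/matrixP => i z; rewrite ord1 [RHS]mxE.
    rewrite summxE; transitivity ((v *m M) 0 i); last by rewrite vM mxE.
    by rewrite mxE; apply: eq_bigr => h _; rewrite -scalemxAr !mxE.
  rewrite -(eqP (freeM : \rank M == k)).
  have -> : M = colsub (@enum_val _ I) M *m rowsub (@enum_val _ I) 1%:M.
    apply/matrixP => j i; rewrite [RHS]mxE.
    under eq_bigr => h _ do
      rewrite [colsub _ _ _ _]mxE [rowsub _ _ _ _]mxE [1%:M _ _]mxE.
    have [iI|iI] := boolP (i \in I).
      rewrite (bigD1 (enum_rank_in iI i))//= enum_rankK_in// eqxx mulr1.
      rewrite big1 ?addr0// => h hi; case: eqP => [hE|]; last by rewrite mulr0.
      by case/eqP: hi; apply: enum_val_inj; rewrite hE enum_rankK_in.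
    rewrite Mz// big1// => h _; case: eqP => [hE|]; rewrite ?mulr0//.
    by move: iI; rewrite -hE enum_valP.
  by rewrite mulmx_max_rank.
move=> kI.
pose e (j : 'I_k) : 'I_n := @enum_val _ I (widen_ord kI j).
exists (fun j _ => X *m delta_mx (e j) 0); split=> [j|c c0 j].
  apply/solE => i Dl; rewrite mxE andbT; case: eqP => // ie.
  have := enum_valP (widen_ord kI j); rewrite -/(e j) -ie inE.
  by rewrite (negbTE Dl).
have := c0 tt Logic.I.
rewrite (eq_bigr (fun j => X *m (c j *: delta_mx (e j) 0))); last first.
  by move=> i _; rewrite scalemxAr.
rewrite -mulmx_sumr => /(congr1 (mulmx (invmx X))); rewrite mulKmx// mulmx0.
move=> /matrixP/(_ (e j) 0); rewrite summxE !mxE (bigD1 j)//= big1.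
  by rewrite addr0 !mxE !eqxx mulr1.
move=> i ij; rewrite !mxE andbT (inj_eq enum_val_inj) -val_eqE /= val_eqE.
by rewrite eq_sym (negbTE ij) mulr0.
Qed.

Lemma multiplicity_indep_sizes (R : realType) (d : nat) (T : Type)
    (p : eigenproblem R d T) (l : R[i]) (m : nat) :
  indep_sizes p l = [set k | (k <= m)%N] -> multiplicity p l = (m%:R)%:E.
Proof.
move=> pm; rewrite /multiplicity -/(indep_sizes p l) pm.
apply/eqP; rewrite eq_le; apply/andP; split.
  by apply: ge_ereal_sup => _ [k /= km <-]; rewrite lee_fin ler_nat.
by apply: ereal_sup_ubound; exists m => /=.
Qed.

(** Every diagonal entry is counted once, at its own value. *)
Lemma sharp1_diag (R : realType) (d n : nat) (T : Type)
    (p : eigenproblem R d T) (D : 'rV[R[i]]_n) :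
  (forall l, indep_sizes p l = [set k | (k <= diag_mult D l)%N]) ->
  sharp1 p = (n%:R)%:E.
Proof.
move=> pD; rewrite /sharp1.
pose s := undup [seq D 0 i | i : 'I_n].
have specE : spectrum p = [set` s].
  apply/seteqP; split=> l.
    move=> /spectrumE; rewrite pD /= /diag_mult => /card_gt0P[j]; rewrite inE => /eqP <-.
    by rewrite mem_undup map_f// mem_enum.
  rewrite /= mem_undup => /mapP[i _ ->]; apply/spectrumE; rewrite pD /= /diag_mult.
  by apply/card_gt0P; exists i; rewrite inE.
rewrite specE esum_fset; [|exact: finite_seq|]; last first.
  by move=> l _; rewrite (multiplicity_indep_sizes (pD l)) lee_fin.
rewrite -fsbig_seq ?undup_uniq//=.
rewrite (eq_bigr (fun l => ((diag_mult D l)%:R)%:E)); last first.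
  by move=> l _; rewrite (multiplicity_indep_sizes (pD l)).
rewrite sumEFin -natr_sum; congr (_%:R%:E).
under eq_bigr do rewrite /diag_mult -sum1_card.
rewrite (exchange_big_dep predT)//=.
rewrite (eq_bigr (fun=> 1%N)) ?sum1_card ?card_ord// => i _.
rewrite sum1_count (eq_count (a2 := pred1 (D 0 i))); last first.
  by move=> l; rewrite inE eq_sym.
by rewrite count_uniq_mem ?undup_uniq// mem_undup map_f// mem_enum.
Qed.

End Solutions.

(** * The discrete problem as a Hermitian pencil *)

Section DiscreteProblem.
Local Open Scope classical_set_scope.
Local Open Scope ring_scope.
Local Open Scope sesquilinear_scope.
Local Open Scope complex_scope.

Lemma adjmxB (C : numClosedFieldType) m n (A B : 'M[C]_(m, n)) :
  (A - B)^t* = A^t* - B^t*.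
Proof. by rewrite linearB/= map_mxB. Qed.

Lemma adjmx_sum (C : numClosedFieldType) m n k (F : 'I_k -> 'M[C]_(m, n)) :
  (\sum_i F i)^t* = \sum_i (F i)^t*.
Proof. by rewrite linear_sum/= map_mx_sum. Qed.

Lemma adjmx_col (C : numClosedFieldType) m1 m2 n (A : 'M[C]_(m1, n))
  (B : 'M[C]_(m2, n)) : (col_mx A B)^t* = row_mx (A^t*) (B^t*).
Proof. by rewrite tr_col_mx map_row_mx. Qed.

Lemma adjmxN (C : numClosedFieldType) m n (A : 'M[C]_(m, n)) :
  (- A)^t* = - A^t*.
Proof. by rewrite linearN/= map_mxN. Qed.

Lemma mx_eq0_adj (C : numClosedFieldType) m (x : 'cV[C]_m) :
  (forall z : 'cV[C]_m, z^t* *m x = 0) -> x = 0.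
Proof.
move=> h; apply/matrixP => i j; rewrite ord1 [RHS]mxE.
have /matrixP/(_ 0 0) := h (delta_mx i 0).
by rewrite trmx_delta map_delta_mx -rowE !mxE.
Qed.

(** The solutions of a self-adjoint boundary condition form a Lagrangian
    subspace: the vectors [(B^* z, - A^* z)] solve it since [A B^* = B A^*], and
    both spaces have dimension [n]. *)
Lemma lagrangian_param (C : numClosedFieldType) n (A B : 'M[C]_n) (p q : 'cV[C]_n) :
  \rank (row_mx A B) = n -> A *m B^t* = B *m A^t* -> A *m p + B *m q = 0 ->
  exists z, p = B^t* *m z /\ q = - (A^t* *m z).
Proof.
move=> rk sa pq.
(* Row vectors carry the linear algebra, so [K] lists the transposed
   [(B^* z, - A^* z)]. *)
pose K : 'M[C]_(n, n + n) := row_mx (map_mx Num.conj B) (- map_mx Num.conj A).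
have rkK : \rank K = n.
  rewrite -[RHS]rk -[RHS](mxrank_map Num.conj (row_mx A B)) map_row_mx.
  have -> : K = row_mx (map_mx Num.conj A) (map_mx Num.conj B) *m block_mx 0 (- 1%:M) 1%:M 0.
    by rewrite mul_row_block !mulmx0 !mulmx1 addr0 add0r mulmxN mulmx1.
  rewrite mxrankMfree// row_free_unit.
  have /mulmx1_unit[]// : block_mx 0 (- 1%:M) 1%:M 0 *m block_mx 0 1%:M (- 1%:M) 0 = 1%:M :> 'M[C]_(n + n).
  rewrite mulmx_block !mulmx0 !mul0mx !mulmx1 !mulNmx !mul1mx.
  by rewrite opprK !addr0 !add0r -scalar_mx_block.
pose M : 'M[C]_(n + n, n) := (row_mx A B)^T.
have rkM : \rank (kermx M) = n by rewrite mxrank_ker mxrank_tr rk addnK.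
have KM : (K <= kermx M)%MS.
  apply/sub_kermxP; rewrite /K /M tr_row_mx mul_row_col mulNmx.
  apply/eqP; rewrite subr_eq0; apply/eqP.
  have := congr1 trmx sa; rewrite !trmx_mul => h; rewrite -[LHS]/(_ *m _).
  by move: h; rewrite -!map_trmx !trmxK.
have {}KM : (K == kermx M)%MS.
  by rewrite -(geq_leqif (mxrank_leqif_eq KM)) rkK rkM.
have : ((col_mx p q)^T <= kermx M)%MS.
  by apply/sub_kermxP; rewrite /M -trmx_mul mul_row_col pq trmx0.
rewrite -(eqmxP KM) => /submxP[x] /(congr1 trmx); rewrite trmxK trmx_mul => h.
exists x^T; move: h; rewrite /K tr_row_mx mul_col_mx => /eq_col_mx[-> ->].
by rewrite linearN/= mulNmx !map_trmx.
Qed.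

(** Coordinates on the sequences [u_0, ..., u_(N+1)] whose boundary vector
    [(-u_0, u_(N+1))] lies in the range of [B^*]: the inner terms are free, and
    the two ends together range over a space of dimension [rank B]. The matrix
    [F i] extracts [u_i] from the coordinates, and [Z] extracts a [z] with
    [(-u_0, u_(N+1)) = B^* z]. *)
Lemma boundary_coordinates (C : numClosedFieldType) (d N : nat) (B : 'M[C]_(d + d)) :
  exists (F : nat -> 'M[C]_(d, N * d + \rank B)) (Z : 'M[C]_(d + d, N * d + \rank B)),
  [/\ col_mx (- F 0%N) (F N.+1) = B^t* *m Z,
      forall c : 'cV_(N * d + \rank B),
        (forall i, (i <= N.+1)%N -> F i *m c = 0) -> c = 0 &
      forall (u : nat -> 'cV[C]_d) z, col_mx (- u 0%N) (u N.+1) = B^t* *m z ->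
        exists c, forall i, (i <= N.+1)%N -> u i = F i *m c].
Proof.
have [T TE] : exists T, row_base B = T *m B by apply/submxP; rewrite eq_row_base.
have [T' TE'] : exists T', B = T' *m row_base B by apply/submxP; rewrite eq_row_base.
(* The columns of [Y] form a basis of the range of [B^*]. *)
pose Y := (row_base B) ^t*.
have Yinj (c : 'cV_(\rank B)) : Y *m c = 0 -> c = 0.
  move=> Yc; have h : c^t* *m row_base B = 0 *m row_base B.
    have := congr1 (fun X => X^t*) Yc.
    by rewrite /Y adjmxM trmxCK trmx0 map_mx0 mul0mx.
  by rewrite -[c]trmxCK (row_free_inj (row_base_free B) h) trmx0 map_mx0.
pose sel (i : 'I_N) : 'M[C]_(d, N * d) :=
  \matrix_(k, m) (m == mxvec_index i k)%:R.
have selE i (x : 'cV_(N * d)) k j : (sel i *m x) k j = x (mxvec_index i k) j.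
  rewrite mxE (bigD1 (mxvec_index i k))//= big1 => [|m /negbTE mk].
    by rewrite addr0 mxE eqxx mul1r.
  by rewrite mxE mk mul0r.
pose F i : 'M[C]_(d, N * d + \rank B) :=
  if i == 0%N then row_mx 0 (- usubmx Y)
  else if i == N.+1 then row_mx 0 (dsubmx Y)
  else row_mx (oapp sel 0 (insub i.-1)) 0.
have F0 : F 0%N = row_mx 0 (- usubmx Y) by [].
have FN : F N.+1 = row_mx 0 (dsubmx Y) by rewrite /F/= eqxx.
have Fi (i : 'I_N) : F i.+1 = row_mx (sel i) 0.
  by rewrite /F /= eqSS (ltn_eqF (ltn_ord i)) valK.
exists F, (row_mx 0 (T^t*)); split.
- rewrite F0 FN mul_mx_row mulmx0 -adjmxM -TE -/Y opp_row_mx oppr0 opprK.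
  by rewrite -[in RHS](vsubmxK Y) -block_mxEv block_mxEh col_mx0.
- move=> c Fc; rewrite -[c]vsubmxK; rewrite -[RHS](@col_mx0 _ (N * d) _ 1).
  congr col_mx.
    apply/matrixP => m j; case/mxvec_indexP: m => i k.
    have := Fc i.+1 (ltnW (ltn_ord i : (i.+1 < N.+1)%N)).
    rewrite Fi -[c]vsubmxK mul_row_col mul0mx addr0.
    by move=> /matrixP/(_ k j); rewrite selE col_mxKu !mxE.
  apply: Yinj; rewrite -[Y]vsubmxK mul_col_mx.
  have := Fc 0%N isT; rewrite F0 -[c]vsubmxK mul_row_col mul0mx add0r col_mxKd.
  rewrite mulNmx => /eqP; rewrite oppr_eq0 => /eqP ->.
  have := Fc N.+1 (leqnn _); rewrite FN -[c]vsubmxK mul_row_col mul0mx add0r.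
  by rewrite col_mxKd => ->; rewrite col_mx0.
- move=> u z; rewrite {1}TE' adjmxM -/Y -mulmxA => uz.
  exists (col_mx (\col_m mxvec (\matrix_(i < N) (u i.+1)^T) 0 m) (T'^t* *m z)).
  move: uz; rewrite -[Y]vsubmxK mul_col_mx => /eq_col_mx[u0 uN].
  case=> [_|i]; first by rewrite F0 mul_row_col mul0mx add0r mulNmx -u0 opprK.
  rewrite ltnS leq_eqVlt => /predU1P[->|iN].
    by rewrite FN mul_row_col mul0mx add0r.
  rewrite (Fi (Ordinal iN)) mul_row_col mul0mx addr0.
  by apply/matrixP => k j; rewrite selE mxE mxvecE !mxE ord1.
Qed.

Lemma sum_by_parts (C : numClosedFieldType) d n N (X : nat -> 'M[C]_(d, n))
    (v : nat -> 'cV[C]_d) :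
  \sum_(i < N.+1) (X i)^t* *m (v i - v i.+1) =
  (X 0%N)^t* *m v 0%N - (X N)^t* *m v N.+1 +
    \sum_(j < N) (X j.+1 - X j)^t* *m v j.+1.
Proof.
elim: N => [|N IH]; first by rewrite big_ord1 big_ord0 addr0 mulmxBr.
rewrite big_ord_recr /= IH [in RHS]big_ord_recr /= adjmxB mulmxBl mulmxBr.
set S := \sum_(i < N) _; set a := _ *m v 0%N; set b := _ *m v N.+1.
set c := _ *m v N.+1; set e := _ *m v N.+2; apply/matrixP => i j.
by rewrite !mxE; ring.
Qed.

(** Here [F] and [Z] are coordinates as in [boundary_coordinates]; the sequences
    [u i = F i *m c] are called admissible. *)
Section DiscretePencil.
Variables (C : numClosedFieldType) (d M : nat).
Variables (P Q W : nat -> 'M[C]_d) (A B : 'M[C]_(d + d)).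
Let N := M.+1.
Hypothesis hP : forall j, (1 <= j <= N)%N -> (P j)^t* = P j.
Hypothesis hQ : forall i, (i <= N)%N -> (Q i)^t* = Q i.
Hypothesis hW : forall i, (i <= N)%N -> (W i)^t* = W i.
Hypothesis posW : forall i, (i <= N)%N ->
  forall x : 'cV[C]_d, x != 0 -> 0 < (x^t* *m W i *m x) 0 0.
Hypothesis rkAB : \rank (row_mx A B) = (d + d)%N.
Hypothesis saAB : A *m B^t* = B *m A^t*.

Variables (n : nat) (F : nat -> 'M[C]_(d, n)) (Z : 'M[C]_(d + d, n)).
Hypothesis FZ : col_mx (- F 0%N) (F N) = B^t* *m Z.
Hypothesis Finj : forall c : 'cV_n,
  (forall i, (i <= N)%N -> F i *m c = 0) -> c = 0.
Hypothesis Fsurj : forall (u : nat -> 'cV[C]_d) z,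
  col_mx (- u 0%N) (u N) = B^t* *m z ->
  exists c, forall i, (i <= N)%N -> u i = F i *m c.

Definition mass_form : 'M[C]_n := \sum_(i < N.+1) (F i)^t* *m W i *m F i.

(** The Dirichlet form of the discrete equation on admissible sequences. The last
    term is what the boundary condition leaves of the boundary terms of the
    summation by parts. *)
Definition energy_form : 'M[C]_n :=
  \sum_(j < N) (F j.+1 - F j)^t* *m P j.+1 *m (F j.+1 - F j)
  + \sum_(i < N.+1) (F i)^t* *m Q i *m F i
  + Z^t* *m (B *m A^t*) *m Z.
Local Notation G := mass_form.
Local Notation H := energy_form.

Lemma herm_energy_form : H^t* = H.
Proof.
rewrite /H !linearD/= !map_mxD !linear_sum/= !map_mx_sum; congr (_ + _ + _).
- apply: eq_bigr => j _; rewrite !adjmxM trmxCK mulmxA; congr (_ *m _ *m _).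
  by rewrite hP//= ltn_ord.
- apply: eq_bigr => i _; rewrite !adjmxM trmxCK mulmxA hQ//.
  by rewrite -ltnS ltn_ord.
- by rewrite !adjmxM !trmxCK saAB !mulmxA.
Qed.

Lemma herm_mass_form : G^t* = G.
Proof.
rewrite /G adjmx_sum; apply: eq_bigr => i _.
by rewrite !adjmxM trmxCK mulmxA hW// -ltnS ltn_ord.
Qed.

Lemma posdef_mass_form (c : 'cV[C]_n) : c != 0 -> 0 < (c^t* *m G *m c) 0 0.
Proof.
have W_ge0 i (x : 'cV[C]_d) : (i <= N)%N -> 0 <= (x^t* *m W i *m x) 0 0.
  move=> iN; have [->|x0] := eqVneq x 0; first by rewrite mulmx0 mxE.
  by apply/ltW; exact: posW iN _ x0.
move=> c0.
have GE : (c^t* *m G *m c) 0 0 =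
    \sum_(i < N.+1) ((F i *m c)^t* *m W i *m (F i *m c)) 0 0.
  rewrite /G mulmx_sumr mulmx_suml summxE; apply: eq_bigr => i _.
  by rewrite adjmxM !mulmxA.
have i_ge0 (i : 'I_N.+1) : true ->
    0 <= ((F i *m c)^t* *m W i *m (F i *m c)) 0 0.
  by move=> _; exact: W_ge0 (ltn_ord i).
rewrite GE lt_neqAle sumr_ge0// andbT eq_sym; apply: contra c0.
rewrite psumr_eq0// => /allP h; apply/eqP/Finj => i iN.
have /(_ (mem_index_enum _))/eqP := h (Ordinal (iN : (i < N.+1)%N)).
move=> /= Wi; apply/eqP; apply: contraPT Wi => Fc.
by apply/eqP; rewrite gt_eqF//; exact: posW iN _ Fc.
Qed.

(** Summation by parts: the residual of the discrete equation at the sequence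
    [F i *m c], tested against all admissible sequences, is the residual of the
    pencil up to a term that vanishes when [q = (v 0, v N.+1)] satisfies the
    boundary condition, that is, when [B (A^* Z c + q) = 0]. *)
Lemma residualE (l : C) (c : 'cV[C]_n) (v : nat -> 'cV[C]_d) :
  (forall j, (j < N)%N -> v j.+1 = P j.+1 *m (F j.+1 *m c - F j *m c)) ->
  \sum_(i < N.+1) (F i)^t* *m
     (v i - v i.+1 + (Q i - l *: W i) *m (F i *m c)) =
  H *m c - l *: (G *m c)
  - Z^t* *m (B *m (A^t* *m (Z *m c) + col_mx (v 0%N) (v N.+1))).
Proof.
move=> vE.
under eq_bigr do rewrite mulmxDr.
rewrite big_split/= sum_by_parts.
have -> : \sum_(j < N) (F j.+1 - F j)^t* *m v j.+1 =
    (\sum_(j < N) (F j.+1 - F j)^t* *m P j.+1 *m (F j.+1 - F j)) *m c.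
  by rewrite mulmx_suml; apply: eq_bigr => j _; rewrite vE// -mulmxBl !mulmxA.
have -> : \sum_(i < N.+1) (F i)^t* *m ((Q i - l *: W i) *m (F i *m c)) =
    (\sum_(i < N.+1) (F i)^t* *m Q i *m F i) *m c - l *: (G *m c).
  rewrite /G !mulmx_suml scaler_sumr -sumrB; apply: eq_bigr => i _.
  by rewrite mulmxBl mulmxBr -!scalemxAl -scalemxAr !mulmxA.
have -> : (F 0%N)^t* *m v 0%N - (F N)^t* *m v N.+1 =
    - (Z^t* *m (B *m col_mx (v 0%N) (v N.+1))).
  have := congr1 (fun X => X^t* *m col_mx (v 0%N) (v N.+1)) FZ.
  rewrite /= adjmx_col adjmxM trmxCK mul_row_col adjmxN mulNmx -mulmxA => <-.
  by rewrite opprD opprK.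
rewrite /H !mulmxDl !mulmxDr !mulmxA.
set a := G *m c; set b := _ *m c; set e := _ *m c; set g := _ *m c.
set f := _ *m col_mx _ _; apply/matrixP => i j.
by rewrite !mxE; ring.
Qed.

(** The boundary condition makes the sequence admissible and cancels the boundary
    term of [residualE]. *)
Lemma pencil_of_discrete (l : C) (u v : nat -> 'cV[C]_d) :
  (forall j, (j < N)%N -> v j.+1 = P j.+1 *m (u j.+1 - u j)) ->
  (forall i, (i <= N)%N -> v i - v i.+1 + (Q i - l *: W i) *m u i = 0) ->
  A *m col_mx (- u 0%N) (u N) + B *m col_mx (v 0%N) (v N.+1) = 0 ->
  exists2 c, forall i, (i <= N)%N -> u i = F i *m c & H *m c = l *: (G *m c).
Proof.
move=> vE eq_u bc; have [z [zp zq]] := lagrangian_param rkAB saAB bc.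
have [c cE] := Fsurj zp; exists c => //.
have vE' j : (j < N)%N -> v j.+1 = P j.+1 *m (F j.+1 *m c - F j *m c).
  by move=> jN; rewrite vE// !cE// ltnW.
have := residualE l vE'.
rewrite big1; last first.
  by move=> i _; rewrite -cE -1?ltnS// eq_u ?mulmx0// -ltnS.
have -> : B *m (A^t* *m (Z *m c) + col_mx (v 0%N) (v N.+1)) = 0.
  rewrite mulmxDr mulmxA -saAB -mulmxA (mulmxA (B^t*)) -FZ mul_col_mx mulNmx.
  by rewrite -!cE.
by rewrite mulmx0 subr0 => /esym/eqP; rewrite subr_eq0 => /eqP.
Qed.

(** The end equations hold by the choice of [v 0] and [v N.+1]. The inner
    equations come from testing the residual against sequences supported at one
    inner index, and then the boundary condition from sequences with arbitrary
    end values [B^* z]. *)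
Lemma discrete_of_pencil (l : C) (c : 'cV[C]_n) (v : nat -> 'cV[C]_d) :
  H *m c = l *: (G *m c) ->
  (forall j, (j < N)%N -> v j.+1 = P j.+1 *m (F j.+1 *m c - F j *m c)) ->
  v 0%N = v 1%N - (Q 0%N - l *: W 0%N) *m (F 0%N *m c) ->
  v N.+1 = v N + (Q N - l *: W N) *m (F N *m c) ->
  (forall i, (i <= N)%N -> v i - v i.+1 + (Q i - l *: W i) *m (F i *m c) = 0) /\
  A *m col_mx (- (F 0%N *m c)) (F N *m c) + B *m col_mx (v 0%N) (v N.+1) = 0.
Proof.
move=> HG vE v0 vN.
pose r i := v i - v i.+1 + (Q i - l *: W i) *m (F i *m c).
have res := residualE l vE; rewrite HG subrr sub0r in res.
set q := col_mx (v 0%N) (v N.+1) in res *.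
have test (X : nat -> 'cV[C]_d) z : col_mx (- X 0%N) (X N) = B^t* *m z ->
    \sum_(i < N.+1) (X i)^t* *m r i
      = - (z^t* *m (B *m (A^t* *m (Z *m c) + q))).
  move=> Xz; have [e Xe] := Fsurj Xz.
  transitivity (e^t* *m (\sum_(i < N.+1) (F i)^t* *m r i)).
    rewrite mulmx_sumr; apply: eq_bigr => i _.
    by rewrite Xe ?adjmxM ?mulmxA// -ltnS.
  rewrite res mulmxN !mulmxA; congr (- (_ *m _)).
  have : (B^t* *m Z *m e)^t* = (B^t* *m z)^t*.
    by rewrite -FZ -Xz mul_col_mx mulNmx !Xe.
  by rewrite !adjmxM trmxCK !mulmxA.
have r0 : r 0%N = 0 by rewrite /r v0 addrAC subrK subrr.
have rN : r N = 0 by rewrite /r vN opprD addrA subrr sub0r addNr.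
(* The test sequence is supported at [i], with [z = 0]. *)
have rI i : (0 < i < N)%N -> r i = 0.
  move=> /andP[i0 iN]; apply: mx_eq0_adj => x.
  have := test (fun j => if j == i then x else 0) 0.
  rewrite (ltn_eqF i0) (gtn_eqF iN) oppr0 col_mx0 mulmx0 => /(_ erefl).
  rewrite trmx0 map_mx0 mul0mx oppr0 => <-.
  rewrite (bigD1 (Ordinal (ltnW iN : (i < N.+1)%N)))//= eqxx big1 ?addr0//.
  by move=> j; rewrite -val_eqE /= => /negbTE ->; rewrite trmx0 map_mx0 mul0mx.
have r_eq0 i : (i <= N)%N -> r i = 0.
  rewrite leq_eqVlt => /predU1P[->//|iN]; have [->//|i0] := posnP i.
  by apply: rI; rewrite i0.
split=> //.
have Bq : B *m (A^t* *m (Z *m c) + q) = 0.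
  apply: mx_eq0_adj => z.
  have := test (fun j => if j == 0%N then - usubmx (B^t* *m z)
                         else if j == N then dsubmx (B^t* *m z) else 0) z.
  rewrite /= eqxx opprK vsubmxK => /(_ erefl); rewrite big1; last first.
    by move=> i _; rewrite r_eq0 ?mulmx0// -ltnS.
  by move/esym/eqP; rewrite oppr_eq0 => /eqP.
move: Bq; rewrite mulmxDr mulmxA -saAB -mulmxA (mulmxA (B^t*)) -FZ mul_col_mx.
by rewrite mulNmx.
Qed.
End DiscretePencil.

(** [P_j Delta u_{j-1}], the discrete counterpart of [P y']. *)
Definition momentum (R : realType) d (tau : discrete_eq R d)
    (u : int -> 'cV[R[i]]_d) (j : nat) : 'cV[R[i]]_d :=
  invmx (dPinv tau j) *m Delta u (j%:Z - 1).

Lemma subz1S (k : nat) : k.+1%:Z - 1 = k%:Z.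
Proof. by rewrite intS addrC addKr. Qed.

Lemma momentumS (R : realType) d (tau : discrete_eq R d)
    (u : int -> 'cV[R[i]]_d) (j : nat) :
  momentum tau u j.+1 = invmx (dPinv tau j.+1) *m (u j.+1%:Z - u j%:Z).
Proof. by rewrite /momentum /Delta subrK subz1S. Qed.

Lemma momentum0 (R : realType) d (tau : discrete_eq R d)
    (u : int -> 'cV[R[i]]_d) :
  dPinv tau 0 = 1%:M -> momentum tau u 0%N = Delta u (-1).
Proof. by rewrite /momentum => ->; rewrite invmx1 mul1mx sub0r. Qed.

Lemma momentum_last (R : realType) d (tau : discrete_eq R d) (N : nat)
    (u : int -> 'cV[R[i]]_d) :
  dPinv tau N.+1 = 1%:M -> momentum tau u N.+1 = Delta u N%:Z.
Proof. by rewrite /momentum => ->; rewrite invmx1 mul1mx subz1S. Qed.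

Lemma discrete_solutionE (R : realType) d N (tau : discrete_eq R d) l
    (u : int -> 'cV[R[i]]_d) :
  discrete_solution N tau l u <-> forall i, (i <= N)%N ->
    momentum tau u i - momentum tau u i.+1
      + (dQ tau i - l *: dW tau i) *m u i%:Z = 0.
Proof.
have eqE i : momentum tau u i - momentum tau u i.+1
      + (dQ tau i - l *: dW tau i) *m u i%:Z =
   - (invmx (dPinv tau i.+1) *m Delta u i%:Z
        - invmx (dPinv tau i) *m Delta u (i%:Z - 1)) + dQ tau i *m u i%:Z
   - l *: (dW tau i *m u i%:Z).
  by rewrite /momentum subz1S mulmxBl -scalemxAl addrA opprB.
split=> h; first by move=> i iN; rewrite eqE h// subrr.
by rewrite /discrete_solution => i iN; apply/eqP; rewrite -subr_eq0 -eqE h.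
Qed.

(** For every [l] the solutions correspond to those of the pencil of
    [energy_form] and [mass_form], whose diagonal form [D] does not depend on
    [l]. *)
Lemma discrete_diagonalizable (R : realType) (d N : nat) (tau : discrete_eq R d)
    (A B : 'M[R[i]]_(d + d)) : (0 < N)%N ->
  dPinv tau 0 = 1%:M -> dPinv tau N.+1 = 1%:M ->
  (forall j, (1 <= j <= N)%N -> (dPinv tau j)^t* = dPinv tau j) ->
  (forall i, (i <= N)%N -> (dQ tau i)^t* = dQ tau i) ->
  (forall i, (i <= N)%N -> posdefmx (dW tau i)) ->
  \rank (row_mx A B) = (d + d)%N -> A *m B^t* = B *m A^t* ->
  exists D : 'rV[R[i]]_((N - 1) * d + \rank B), forall l,
    indep_sizes (discrete_problem0 N tau (bc_class A B)) l =
    [set k | (k <= diag_mult D l)%N].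
Proof.
case: N => // M _; rewrite subn1 /=; set N := M.+1.
move=> P0 PN hPinv hQ hW rkAB saAB.
have [F [Z [FZ Finj Fsurj]]] := boundary_coordinates M B.
pose P j := invmx (dPinv tau j); pose Q := dQ tau; pose W := dW tau.
have hP j : (1 <= j <= N)%N -> (P j)^t* = P j.
  by move=> jN; rewrite /P trmx_inv map_invmx hPinv.
have hW' i : (i <= N)%N -> (W i)^t* = W i by move=> iN; apply/hermmxP/(hW i iN).1.
have posW i : (i <= N)%N -> forall x : 'cV_d, x != 0 -> 0 < (x^t* *m W i *m x) 0 0.
  by move=> iN; exact: (hW i iN).2.
pose G := mass_form M W F; pose H := energy_form M P Q A B F Z.
have hH : H^t* = H by exact: herm_energy_form.
have hG : G^t* = G by exact: herm_mass_form.
have pG (c : 'cV_(M * d + \rank B)) : c != 0 -> 0 < (c^t* *m G *m c) 0 0.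
  exact: posdef_mass_form.
have [X Xu [D [XG XH]]] := simultaneous_diagonalization hH hG pG.
exists D => l; rewrite -(indep_sizes_pencil l Xu XG XH).
have SA (k : nat) : k%:Z + 1 = k.+1%:Z by rewrite -PoszD addn1.
have vv0 u : momentum tau u 0%N = Delta u (-1) by exact: momentum0.
have vvN u : momentum tau u N.+1 = Delta u N%:Z by exact: momentum_last.
have DS u j : momentum tau u j.+1 = P j.+1 *m (u j.+1%:Z - u j%:Z) by exact: momentumS.
have solE u := discrete_solutionE N tau l u.
(* [u_{-1}] and [u_{N+1}] are recovered from the equations at the two ends. *)
pose K (k : int) : 'M[R[i]]_(d, M * d + \rank B) :=
  match k with
  | Posz i => if (i <= N)%N then F i else
      F N + (P N *m (F N - F M) + (Q N - l *: W N) *m F N)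
  | Negz _ => F 0%N - (P 1 *m (F 1%N - F 0%N) - (Q 0 - l *: W 0) *m F 0%N)
  end.
pose L (c : unit -> 'cV[R[i]]_(M * d + \rank B)) (k : int) := K k *m c tt.
have Lu c i : (i <= N)%N -> L c i%:Z = F i *m c tt by rewrite /L /= => ->.
apply: (@indep_sizes_inj _ _ _ _ _ _ _ _ L).
- by move=> a u v; apply/funext => k; rewrite /L mulmxDr -scalemxAr.
- by rewrite /= !mulmx0 scaler0.
- move=> a u v /= hu hv; rewrite !mulmxDr -!scalemxAr hu hv.
  by rewrite scalerDr !scalerA mulrC.
- move=> u [/solE su /bc_holdsP bcu].
  have vE j : (j < N)%N -> momentum tau u j.+1 = P j.+1 *m (u j.+1%:Z - u j%:Z).
    by move=> jN; rewrite DS.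
  rewrite -vv0 -vvN in bcu.
  have [c cE HG] := pencil_of_discrete rkAB saAB FZ Fsurj vE su bcu.
  exists (fun=> c) => // -[k|k]; rewrite /discrete_dom /= /L /= => hk.
    case: leqP => kN; first exact: cE.
    have -> : k = N.+1.
      by apply/eqP; rewrite eqn_leq kN andbT; move: hk; rewrite /discrete_dom /= -PoszD lez_nat addn1.
    have vNE : momentum tau u N = P N *m ((F N - F M) *m c).
      by rewrite (DS u M) !cE// mulmxBl.
    have := su N (leqnn _); rewrite vvN vNE cE// => /eqP.
    rewrite addrAC subr_eq0 => /eqP E.
    rewrite mulmxDl [X in _ + X]mulmxDl -!mulmxA E -cE//.
    by rewrite /Delta SA addrC subrK.
  have -> : k = 0%N by case: k hk.
  have v1E : momentum tau u 1%N = P 1 *m ((F 1%N - F 0%N) *m c).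
    by rewrite (DS u 0%N) !cE// mulmxBl.
  have := su 0%N isT; rewrite vv0 v1E cE// => /eqP.
  rewrite addrAC subr_eq0 => /eqP E.
  rewrite mulmxBl [X in _ - X]mulmxBl -!mulmxA -E addrK -cE//.
  by rewrite /Delta opprB addrC subrK.
- move=> c /= HG; set u := L c.
  have uE i : (i <= N)%N -> u i%:Z = F i *m c tt by exact: Lu.
  have vE j : (j < N)%N -> momentum tau u j.+1 = P j.+1 *m (F j.+1 *m c tt - F j *m c tt).
    by move=> jN; rewrite DS !uE// ltnW.
  have v0E : momentum tau u 0%N = momentum tau u 1%N - (Q 0%N - l *: W 0%N) *m (F 0%N *m c tt).
    have um1 : u (-1) = F 0%N *m c tt
        - (P 1 *m ((F 1%N - F 0%N) *m c tt) - (Q 0%N - l *: W 0%N) *m (F 0%N *m c tt)).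
      by rewrite /u /L /= mulmxBl [X in _ - X]mulmxBl -!mulmxA.
    have -> : momentum tau u 0%N = u 0%N - u (-1) by rewrite vv0.
    rewrite um1 (uE 0%N (leq0n _)) (vE 0%N (ltn0Sn _)) -mulmxBl opprB.
    by rewrite addrCA subrr addr0.
  have vNE : momentum tau u N.+1 = momentum tau u N + (Q N - l *: W N) *m (F N *m c tt).
    have uN1 : u N.+1%:Z = F N *m c tt
        + (P N *m ((F N - F M) *m c tt) + (Q N - l *: W N) *m (F N *m c tt)).
      by rewrite /u /L /= ltnn mulmxDl [X in _ + X]mulmxDl -!mulmxA.
    rewrite vvN /Delta SA uN1 uE// [momentum tau u N]vE// -mulmxBl.
    by rewrite addrAC subrr add0r.
  have [eqs bc] := discrete_of_pencil saAB FZ Fsurj HG vE v0E vNE.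
  split; first by apply/solE => i iN; rewrite (uE i iN); exact: (eqs i iN).
  by apply/bc_holdsP; rewrite -vv0 -vvN !uE.
- move=> c _; split=> [h []|h k _]; last by rewrite /L h// mulmx0.
  move=> _; apply: Finj => i iN; rewrite -Lu//; apply: h.
  by rewrite /= /discrete_dom /= -PoszD lez_nat addn1 (leq_trans iN).
Qed.
End DiscreteProblem.

(** * Absolutely continuous functions *)

Section AbsoluteContinuity.
Local Open Scope classical_set_scope.
Local Open Scope ring_scope.
Context {R : realType}.
Notation mu := (@lebesgue_measure R).
Implicit Types (a b : R) (f g : R -> R).

Lemma absolutely_continuous_subitv a b c e f :
  a <= c -> e <= b -> absolutely_continuous a b f -> absolutely_continuous c e f.
Proof.
move=> ac eb acf eps eps0; have [dlt dlt0 h] := acf _ eps0.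
exists dlt => // n s t st; apply: h => i; have [cs [sti te]] := st i.
by rewrite (le_trans ac cs) sti (le_trans te eb).
Qed.

Lemma absolutely_continuous_lincomb a b x y f g :
  absolutely_continuous a b f -> absolutely_continuous a b g ->
  absolutely_continuous a b (fun t => x * f t + y * g t).
Proof.
move=> acf acg e e0.
have K0 : 0 < `|x| + `|y| + 1 by rewrite ltr_wpDl// addr_ge0.
pose e' := e / (`|x| + `|y| + 1).
have e'0 : 0 < e' by rewrite divr_gt0.
have [d1 d10 h1] := acf _ e'0; have [d2 d20 h2] := acg _ e'0.
exists (Num.min d1 d2); first by rewrite lt_min d10.
move=> n s t st disj; rewrite lt_min => /andP[sd1 sd2].
have {}h1 := h1 n s t st disj sd1; have {}h2 := h2 n s t st disj sd2.
apply: (@le_lt_trans _ _ (`|x| * (\sum_i `|f (t i) - f (s i)|) +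
                      `|y| * (\sum_i `|g (t i) - g (s i)|))).
  rewrite !mulr_sumr -big_split/=; apply: ler_sum => i _.
  rewrite -!normrM; apply: le_trans (ler_normD _ _).
  by rewrite le_eqVlt; apply/orP; left; apply/eqP; congr `| _ |; ring.
apply: (@le_lt_trans _ _ (`|x| * e' + `|y| * e')).
  by apply: lerD; apply: ler_wpM2l => //; exact: ltW.
rewrite -mulrDl /e' mulrCA -[ltRHS]mulr1 ltr_pM2l//.
by rewrite ltr_pdivrMr// mul1r ltrDl.
Qed.

Lemma is_derive_small (c : R) f (e : R) : is_derive c 1 f 0 -> 0 < e ->
  exists2 r, 0 < r & forall z, `|z - c| < r -> `|f z - f c| <= e * `|z - c|.
Proof.
move=> /is_derive1_caratheodory[g [fg gc gc0]] e0.
have /cvgrPdist_le/(_ e e0)/nbhs_ballP[r /= r0 h] := gc.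
exists r => // z zr; rewrite fg normrM ler_wpM2r//.
have := h z; rewrite /= gc0 sub0r normrN; apply.
by rewrite /ball /= distrC.
Qed.

(* The invariant of the sweep in [absolutely_continuous_derive0]: [L] lists, from
   right to left, the intervals of [U] passed so far, as pairs of end points. *)
Let covered (U : set R) f a (e x : R) :=
  exists L : seq (R * R),
  [/\ forall p, p \in L -> [/\ a <= p.1, p.1 <= p.2 & p.2 <= x],
      pairwise (fun p q : R * R => q.2 <= p.1) L,
      ((\sum_(p <- L) (p.2 - p.1))%:E <= mu (U `&` `]a, x]))%E &
      `|f x - f a| <= e * (x - a) + \sum_(p <- L) `|f p.2 - f p.1|].

Let covered_flat (U : set R) f a (e x z : R) : open U -> a <= x -> x <= z -> 0 < e ->
  `|f z - f x| <= e * (z - x) -> covered U f a e x -> covered U f a e z.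
Proof.
move=> oU ax xz e0 fxz [L [Lx Ldisj Lmu Lf]]; exists L; split=> //.
- by move=> p /Lx[-> -> px]; split => //; exact: le_trans xz.
- apply: le_trans Lmu _; apply: le_measure; rewrite ?inE.
  + by apply: measurableI => //; exact: measurable_realfun.open_measurable.
  + by apply: measurableI => //; exact: measurable_realfun.open_measurable.
  + by apply: setIS => t /=; rewrite !in_itv/= => /andP[-> /le_trans]; apply.
- rewrite -(subrK (f x) (f z)) -addrA; apply: le_trans (ler_normD _ _) _.
  apply: (le_trans (lerD fxz Lf)); rewrite addrA -mulrDr lerD2r.
  by rewrite addrA subrK.
Qed.

Let covered_inside (U : set R) f a (e x z : R) : open U -> a <= x -> x <= z -> 0 < e ->
  `]x, z] `<=` U -> covered U f a e x -> covered U f a e z.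
Proof.
move=> oU ax xz e0 xzU [L [Lx Ldisj Lmu Lf]]; exists ((x, z) :: L); split.
- move=> p; rewrite inE => /predU1P[-> //|/Lx[-> -> px]].
  by split => //; exact: le_trans xz.
- by rewrite /= Ldisj andbT; apply/allP => p /Lx[].
- have mU : measurable U by exact: measurable_realfun.open_measurable.
  rewrite big_cons /= EFinD.
  have -> : U `&` `]a, z] = `]x, z] `|` (U `&` `]a, x]).
    rewrite (@itv_bndbnd_setU _ _ _ (BRight x))//; last first.
    rewrite setIUr setUC; congr (_ `|` _).
    by apply/setIidPr.
  rewrite measureU//; first last.
  + apply/seteqP; split=> t //= [] /[!in_itv]/= /andP[xt _] [_ /andP[_ tx]].
    by move: (lt_le_trans xt tx); rewrite ltxx.
  + by apply: measurableI.
  have muxz : mu `]x, z] = (z - x)%:E.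
    by rewrite lebesgue_measure_itv/= lte_fin; case: ltgtP xz => // -> _; rewrite subrr.
  by apply: leeD => //; rewrite -muxz.
- rewrite big_cons /=; apply: le_trans (ler_distD (f x) _ _) _.
  rewrite addrCA lerD2l.
  apply: le_trans Lf _; rewrite lerD2r.
  by apply: ler_wpM2l; [exact: ltW|rewrite lerD2r].
Qed.

(** An absolutely continuous function with zero derivative almost everywhere is
    constant. The exceptional set lies in an open set [U] of measure less than
    the [dlt] of absolute continuity. Sweep the interval from left to right: near
    a point where the derivative vanishes [f] grows at rate at most [e'], and
    near any other point the sweep stays in [U], where the total increment of [f]
    is less than [e']. The supremum [c] of the points reached in this way is
    reached, and the sweep can be continued from it unless [c = b]. *)
Lemma absolutely_continuous_derive0 a b f : a <= b ->
  absolutely_continuous a b f ->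
  {ae mu, forall x, a < x < b -> is_derive x 1 f 0} ->
  f b = f a.
Proof.
move=> ab acf [Z [mZ Z0 hZ]].
apply/eqP; rewrite -subr_eq0 -normr_le0; apply/ler_addgt0Pr => e e0.
rewrite add0r.
(* The sweep yields [|f b - f a| <= e' (b - a) + e' = e]. *)
pose K := 1 + (b - a).
have K0 : 0 < K by rewrite /K ltr_wpDr// subr_ge0.
pose e' := e / K; have e'0 : 0 < e' by rewrite divr_gt0.
have [dlt dlt0 hdlt] := acf _ e'0.
(* At the end points no derivative is given. *)
pose Z' := Z `|` ([set a] `|` [set b]).
have mZ' : measurable Z' by do 2 apply: measurableU => //.
have Z'0 : mu Z' = 0%E.
  rewrite /Z' setUA measureU0//; [|exact: measurableU|exact: lebesgue_measure_set1].
  by rewrite measureU0//; exact: lebesgue_measure_set1.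
have [U [oU Z'U muU]] : exists U, [/\ open U, Z' `<=` U & (mu U < dlt%:E)%E].
  have Zoo : (mu Z' < +oo)%E by rewrite Z'0.
  have [U [oU Z'U ltU]] := lebesgue_regularity_outer mZ' Zoo dlt0.
  exists U; split=> //; rewrite -(setDUK Z'U) setUC measureU0//.
  by apply: measurableD => //; exact: measurable_realfun.open_measurable.
have gauge c : a <= c <= b -> exists2 r, 0 < r & forall y z,
    a <= y -> y <= c -> c <= z -> z <= b -> c - r < y -> z < c + r ->
    covered U f a e' y -> covered U f a e' z.
  move=> /andP[ac cb]; have [cU|cU] := pselect (U c).
    have /nbhs_ballP[r /= r0 rU] : nbhs c U by exact: open_nbhs_nbhs.
    exists r => // y z ay yc cz zb cy zc; apply: covered_inside => //.
      exact: le_trans cz.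
    move=> t /=; rewrite in_itv/= => /andP[yt tz]; apply: rU.
    rewrite /ball /= distrC ltr_norml; apply/andP; split; lra.
  have : is_derive c 1 f 0.
    apply: contrapT => nd; apply: cU; apply: Z'U.
    have [->|ca] := eqVneq c a; first by right; left.
    have [->|cb'] := eqVneq c b; first by right; right.
    left; apply: hZ => /=; apply: contra_not nd; apply.
    by rewrite !lt_neqAle ac cb eq_sym ca cb'.
  move=> /is_derive_small/(_ e'0)[r r0 hr]; exists r => // y z ay yc cz zb cy zc.
  apply: covered_flat => //; first exact: le_trans cz.
  have hz : `|f z - f c| <= e' * (z - c).
    rewrite -[z - c]ger0_norm ?subr_ge0//; apply: hr.
    by rewrite ger0_norm ?subr_ge0//; lra.
  have hy : `|f y - f c| <= e' * (c - y).
    rewrite -[c - y]ger0_norm ?subr_ge0// [`|c - y|]distrC; apply: hr.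
    by rewrite ler0_norm ?subr_le0//; lra.
  rewrite -(subrK (f c) (f z)) -addrA; apply: le_trans (ler_normD _ _) _.
  rewrite -[`|f c - _|]distrC; apply: le_trans (lerD hz hy) _.
  by rewrite -mulrDr addrA subrK.
pose S := [set x | a <= x <= b /\ covered U f a e' x].
have Sa : S a.
  split; first by rewrite lexx.
  exists [::]; split=> //; first by rewrite big_nil measure_ge0.
  by rewrite big_nil !subrr normr0 mulr0 addr0.
have Sub : has_sup S.
  by split; [exists a|exists b => x [/andP[]]].
pose c := sup S.
have ac : a <= c by apply: ub_le_sup => //; exact: Sub.2.
have cb : c <= b by apply: ge_sup; [exists a|move=> x [/andP[]]].
have [r r0 hr] := gauge c (introT andP (conj ac cb)).
have [y [/andP[ay yb] Cy] cy] := sup_adherent r0 Sub.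
have yc : y <= c by apply: ub_le_sup; [exact: Sub.2|split => //; rewrite ay].
pose z := Num.min b (c + r / 2).
have cz : c <= z by rewrite le_min cb lerDl divr_ge0// ltW.
have zb : z <= b by rewrite ge_min lexx.
have zc : z < c + r by rewrite gt_min ltrD2l gtr_pMr// invf_lt1// ltr1n orbT.
have Cz : covered U f a e' z by exact: (hr y).
have zc' : z <= c.
  by apply: ub_le_sup; [exact: Sub.2|split => //; rewrite zb (le_trans ac)].
have zbE : z = b.
  move: zc'; rewrite /z /Num.min; case: ifPn => // _.
  by rewrite gerDl => h; have := divr_gt0 r0 (ltr0n _ 2); rewrite ltNge h.
move: Cz; rewrite zbE => -[L [Lx Ldisj Lmu Lf]].
apply: (le_trans Lf).
suff Ls : \sum_(p <- L) `|f p.2 - f p.1| <= e'.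
  apply: (le_trans (lerD (lexx _) Ls)).
  by rewrite -[X in _ + X]mulr1 -mulrDr addrC /e' -/K mulfVK// gt_eqF.
apply/ltW.
rewrite (big_nth (0, 0)) big_mkord; apply: hdlt.
- move=> i; have := Lx _ (mem_nth (0, 0) (ltn_ord i)).
  by case.
- move=> i j ij.
  have /pairwiseP-/(_ (0, 0)) pw := Ldisj.
  have [ij'|ij'|/val_inj ij'] := ltngtP i j; last by rewrite ij' eqxx in ij.
    by right; apply: pw => //; rewrite inE.
  by left; apply: pw => //; rewrite inE.
- rewrite -lte_fin; apply: le_lt_trans muU; apply: le_trans.
    by apply: le_trans Lmu; rewrite (big_nth (0, 0)) big_mkord.
  apply: le_measure; rewrite ?inE.
  + by apply: measurableI => //; exact: measurable_realfun.open_measurable.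
  + exact: measurable_realfun.open_measurable.
  + by move=> ? [].
Qed.

Lemma ae_imply (P Q : R -> Prop) :
  (forall x, P x -> Q x) -> {ae mu, forall x, P x} -> {ae mu, forall x, Q x}.
Proof. by move=> PQ; apply: filterS PQ; exact: (ae_filter_ringOfSetsType mu). Qed.

Lemma ae_imply2 (P Q S : R -> Prop) : (forall x, P x -> Q x -> S x) ->
  {ae mu, forall x, P x} -> {ae mu, forall x, Q x} -> {ae mu, forall x, S x}.
Proof. by move=> PQ; apply: filterS2 PQ; exact: (ae_filter_ringOfSetsType mu). Qed.

(** Indefinite integrals are absolutely continuous, because the integral is
    absolutely continuous as a function of the set. *)
Lemma absolutely_continuous_primitive a b g : mu.-integrable setT (EFin \o g) ->
  absolutely_continuous a b (fun x => \int[mu]_(t in `]-oo, x]) g t).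
Proof.
move=> ig e e0.
have [dlt [dlt0 h]] := integral_normr_continuous ig e0.
exists dlt => // n s t st disj sdlt.
pose I (i : 'I_n) : set R := `]s i, t i]%classic.
have mI i : measurable (I i) by exact: measurable_itv.
have tI : trivIset [set: 'I_n] I.
  apply/trivIsetP => i j _ _ ij; apply/seteqP; split=> // x [].
  rewrite /I /= !in_itv/= => /andP[sx xt] /andP[sx' xt'].
  case: (disj i j ij) => H; [have := le_lt_trans (le_trans xt H) sx'|
    have := le_lt_trans (le_trans xt' H) sx]; by rewrite ltxx.
pose A := \big[setU/set0]_(i < n) I i.
have mA : measurable A by exact: bigsetU_measurable.
have muI i : mu (I i) = (t i - s i)%:E.
  rewrite lebesgue_measure_itv/= lte_fin; have [_ [sti _]] := st i.
  by case: ltgtP sti => // -> _; rewrite subrr.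
have muA : (mu A < dlt%:E)%E.
  rewrite /A measure_bigsetU_ord// (eq_bigr (fun i => (t i - s i)%:E)) => [|i _].
    by rewrite sumEFin lte_fin.
  exact: muI.
apply: le_lt_trans (h A mA muA).
have ing D : measurable D -> mu.-integrable D (EFin \o g).
  by move=> mD; apply: integrableS ig.
have inng D : measurable D -> mu.-integrable D (EFin \o (fun x => `|g x|)).
  by move=> mD; have := integrable_abse (ing D mD).
have -> : \int[mu]_(x in A) `|g x| = \sum_(i < n) \int[mu]_(x in I i) `|g x|.
  rewrite /Rintegral /A ge0_integral_bigsetU//.
  - rewrite (eq_bigr (fun i => (\int[mu]_(x in I i) `|g x|)%:E)); last first.
      move=> i _; rewrite /Rintegral fineK//; apply: integrable_fin_num; [exact: mI|exact: (inng _ (mI i))].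
    by rewrite sumEFin.
  - exact: index_enum_uniq.
  - by apply: sub_trivIset tI.
  - by have /measurable_int := inng A mA.
apply: ler_sum => i _; have [_ [sti _]] := st i.
rewrite Rintegral_itvB//; last exact: ing.
apply: le_normr_Rintegral => //; exact: ing.
Qed.

Lemma Rintegral_itv_oo x y g : mu.-integrable `]x, y[ (EFin \o g) ->
  \int[mu]_(t in `[x, y]) g t = \int[mu]_(t in `]x, y[) g t.
Proof.
move=> ig; rewrite /Rintegral integral_itv_bndoo//.
exact: measurable_int ig.
Qed.

(** Lebesgue's differentiation theorem provides absolutely continuous
    primitives. *)
Lemma ex_primitive a b g : mu.-integrable `]a, b[ (EFin \o g) ->
  exists f, [/\ absolutely_continuous a b f, f a = 0,
    forall x y, a <= x -> x <= y -> y <= b ->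
      f y - f x = \int[mu]_(t in `[x, y]) g t &
    {ae mu, forall x, a < x < b -> is_derive x 1 f (g x)}].
Proof.
move=> ig; pose gT := g \_ `]a, b[%classic.
have igT : mu.-integrable setT (EFin \o gT).
  by move/integrable_mkcond : ig => /(_ (measurable_itv _)); rewrite restrict_EFin.
pose F x := \int[mu]_(t in `]-oo, x]) gT t.
have FB x y : F x - F a - (F y - F a) = F x - F y by rewrite opprB addrA subrK.
exists (fun x => F x - F a); split.
- move=> e e0; have [dlt dlt0 h] := absolutely_continuous_primitive a b igT e0.
  exists dlt => // n s t st disj sdlt; under eq_bigr do rewrite FB.
  exact: h.
- by rewrite subrr.
- move=> x y ax xy yb; rewrite FB Rintegral_itvB//; last exact: integrableS igT.
  have sub : `]x, y[ `<=` `]a, b[ by apply: subset_itvW.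
  have igxy : mu.-integrable `]x, y[ (EFin \o g) by apply: integrableS ig.
  rewrite Rintegral_itv_oo// -Rintegral_itv_bndo_bndc; last exact: integrableS igT.
  apply: eq_Rintegral => t txy; rewrite /gT patchE mem_set//; apply: sub.
  by move: txy; rewrite inE.
have h1 y : mu.-integrable `]-oo, y] (EFin \o gT) by apply: integrableS igT.
have h2 : locally_integrable [set: R] gT.
  by apply: open_integrable_locally => //; exact: openT.
apply: ae_imply (FTC1Ny h1 h2) => x [dF F'] xab.
have -> : g x = gT x by rewrite /gT patchE mem_set//= in_itv.
rewrite -F' derive1E -[X in is_derive _ _ _ X]subr0.
by apply: is_deriveB; exact: DeriveDef.
Qed.

Lemma absolutely_continuous_diff_const a b f g : a <= b ->
  absolutely_continuous a b f -> absolutely_continuous a b g ->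
  {ae mu, forall x, a < x < b ->
     exists2 l, is_derive x 1 f l & is_derive x 1 g l} ->
  f b - f a = g b - g a.
Proof.
move=> ab acf acg fg.
have : 1 * f b + (-1) * g b = 1 * f a + (-1) * g a.
  apply: (absolutely_continuous_derive0 ab
    (absolutely_continuous_lincomb 1 (-1) acf acg)).
  apply: ae_imply fg => x h /h[l fl gl].
  have -> : (fun t => 1 * f t + (-1) * g t) = f - g.
    by apply/funext => t; rewrite mul1r mulN1r.
  by rewrite -(subrr l); apply: is_deriveB.
rewrite !mul1r !mulN1r; lra.
Qed.

(** The fundamental theorem of calculus for absolutely continuous functions:
    the function and a primitive of its derivative differ by a constant. *)
Lemma absolutely_continuous_FTC a b f g : a <= b ->
  absolutely_continuous a b f -> mu.-integrable `]a, b[ (EFin \o g) ->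
  {ae mu, forall x, a < x < b -> is_derive x 1 f (g x)} ->
  f b - f a = \int[mu]_(x in `[a, b]) g x.
Proof.
move=> ab acf ig f'; have [F [acF _ FE F']] := ex_primitive ig.
rewrite -FE//; apply: absolutely_continuous_diff_const => //.
by apply: ae_imply2 f' F' => x fx Fx xab; exists (g x); [exact: fx|exact: Fx].
Qed.
End AbsoluteContinuity.

(** * Matrix-valued functions *)

Section MatrixFunctions.
Local Open Scope classical_set_scope.
Local Open Scope ring_scope.
Local Open Scope sesquilinear_scope.
Local Open Scope complex_scope.
Context {R : realType}.
Notation mu := (@lebesgue_measure R).

(** Relations between real functions and numbers, compatible with linear
    combinations. The instances are absolute continuity, having a given derivative
    at a point, and being integrable with a given integral. One proof extends all
    three to matrices of complex functions. *)
Definition lin_rel (Q : (R -> R) -> R -> Prop) : Prop :=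
  forall x y f g l m, Q f l -> Q g m ->
    Q (fun t => x * f t + y * g t) (x * l + y * m).

Definition mx_rel (Q : (R -> R) -> R -> Prop) (m n : nat)
    (F : R -> 'M[R[i]]_(m, n)) (L : 'M[R[i]]_(m, n)) : Prop :=
  forall i j, Q (fun x => complex.Re (F x i j)) (complex.Re (L i j)) /\
              Q (fun x => complex.Im (F x i j)) (complex.Im (L i j)).

Section MxRel.
Variable Q : (R -> R) -> R -> Prop.
Hypotheses (Qlin : lin_rel Q) (Q0 : Q (fun=> 0) 0).

Let QD f g l m : Q f l -> Q g m -> Q (fun t => f t + g t) (l + m).
Proof.
move=> Qf Qg; have := Qlin 1 1 Qf Qg; rewrite !mul1r.
by under eq_fun do rewrite !mul1r.
Qed.

Let Qsum k (f : 'I_k -> R -> R) (l : 'I_k -> R) : (forall i, Q (f i) (l i)) ->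
  Q (fun t => \sum_i f i t) (\sum_i l i).
Proof.
elim: k f l => [|k IH] f l Qf.
  by rewrite big_ord0; under eq_fun do rewrite big_ord0.
rewrite big_ord_recr; under eq_fun do rewrite big_ord_recr.
by apply: QD => //; apply: IH.
Qed.

Lemma mx_relD m n (F G : R -> 'M[R[i]]_(m, n)) L M :
  mx_rel Q F L -> mx_rel Q G M -> mx_rel Q (fun x => F x + G x) (L + M).
Proof.
move=> QF QG i j; rewrite !mxE !raddfD /=.
under eq_fun do rewrite mxE raddfD.
under [X in _ /\ Q X _]eq_fun do rewrite mxE raddfD.
by have [? ?] := QF i j; have [? ?] := QG i j; split; apply: QD.
Qed.

Lemma mx_rel_sum k m n (F : 'I_k -> R -> 'M[R[i]]_(m, n)) L :
  (forall i, mx_rel Q (F i) (L i)) ->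
  mx_rel Q (fun x => \sum_i F i x) (\sum_i L i).
Proof.
move=> QF i j; rewrite !summxE !raddf_sum /=.
under eq_fun do rewrite summxE raddf_sum.
under [X in _ /\ Q X _]eq_fun do rewrite summxE raddf_sum.
by split; apply: Qsum => h; case: (QF h i j).
Qed.

Let ReM (x y : R[i]) :
  complex.Re (x * y) = complex.Re y * complex.Re x + (- complex.Im y) * complex.Im x.
Proof. by case: x y => [a b] [c e] /=; rewrite mulNr [c * _]mulrC [e * _]mulrC. Qed.

Let ImM (x y : R[i]) :
  complex.Im (x * y) = complex.Im y * complex.Re x + complex.Re y * complex.Im x.
Proof. by case: x y => [a b] [c e] /=; rewrite [e * _]mulrC [c * _]mulrC. Qed.

Lemma mx_rel_mulr m n p (F : R -> 'M[R[i]]_(m, n)) L (c : 'M[R[i]]_(n, p)) :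
  mx_rel Q F L -> mx_rel Q (fun x => F x *m c) (L *m c).
Proof.
move=> QF i j; rewrite !mxE !raddf_sum /=.
under eq_fun do rewrite mxE raddf_sum.
under [X in _ /\ Q X _]eq_fun do rewrite mxE raddf_sum.
split; apply: Qsum => k; have [QR QI] := QF i k.
- by under eq_fun do rewrite /= ReM; rewrite ReM; exact: Qlin.
- by under eq_fun do rewrite /= ImM; rewrite ImM; exact: Qlin.
Qed.

Lemma mx_rel_adj m n (F : R -> 'M[R[i]]_(m, n)) L :
  mx_rel Q F L -> mx_rel Q (fun x => (F x)^t*) (L^t*).
Proof.
move=> QF i j; have [QR QI] := QF j i.
have cR (z : R[i]) : complex.Re (Num.conj z) = complex.Re z by case: z.
have cI (z : R[i]) : complex.Im (Num.conj z) = (-1) * complex.Im z + 0 * complex.Im z.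
  by case: z => a b /=; rewrite mulN1r mul0r addr0.
split.
- rewrite !mxE cR; under eq_fun do rewrite !mxE cR; exact: QR.
- rewrite !mxE cI; under eq_fun do rewrite !mxE cI; exact: Qlin.
Qed.
End MxRel.

Lemma lin_absolutely_continuous a b : lin_rel (fun f _ => absolutely_continuous a b f).
Proof. by move=> x y f g _ _; exact: absolutely_continuous_lincomb. Qed.

Lemma lin_derive (x : R) : lin_rel (fun f l => is_derive x 1 f l).
Proof.
move=> p q f g l m fl gm.
have -> : (fun t => p * f t + q * g t) = p *: f + q *: g by [].
by apply: is_deriveD; apply: is_deriveZ.
Qed.

Lemma lin_integral (I : interval R) :
  lin_rel (fun f l => mu.-integrable [set` I] (EFin \o f) /\
                      \int[mu]_(x in [set` I]) f x = l).
Proof.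
move=> p q f g l m [fi <-] [gi <-].
have cf c h : mu.-integrable [set` I] (EFin \o h) ->
    mu.-integrable [set` I] (EFin \o (fun t => c * h t)).
  move=> hi; have -> : EFin \o (fun t => c * h t) = (fun t => c%:E * (EFin \o h) t)%E by [].
  by apply: integrableZl => //; exact: measurable_itv.
have pf := cf p f fi; have qg := cf q g gi; split.
  have -> : EFin \o (fun t => p * f t + q * g t) =
    ((EFin \o (fun t => (p * f t)%R)) \+ (EFin \o (fun t => (q * g t)%R)))%E by [].
  by apply: integrableD => //; exact: measurable_itv.
by rewrite RintegralD// !RintegralZl.
Qed.

(** Integrability and the value of the integral in one relation, to fit
    [mx_rel]. *)
Definition has_integral (D : set R) m n (F : R -> 'M[R[i]]_(m, n)) L :=
  mx_rel (fun f l => mu.-integrable D (EFin \o f) /\ \int[mu]_(x in D) f x = l) F L.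

Lemma has_integralP (D : set R) m n (F : R -> 'M[R[i]]_(m, n)) L :
  has_integral D F L <-> mx_integrable D F /\ mx_integral D F = L.
Proof.
split=> [h|[h <-]] .
  split=> [i j|]; first by have [[]] := h i j => ? _ [].
  apply/matrixP => i j; rewrite mxE; have [[_ ->] [_ ->]] := h i j.
  by case: (L i j).
by move=> i j; have [] := h i j; rewrite mxE.
Qed.

Lemma ac_cst a b (c : R) : absolutely_continuous a b (fun=> c).
Proof.
move=> e e0; exists 1 => // n s t _ _ _.
by rewrite big1// => i _; rewrite subrr normr0.
Qed.

Lemma mx_ac_sub a b c e m n (F : R -> 'M[R[i]]_(m, n)) : a <= c -> e <= b ->
  mx_absolutely_continuous a b F -> mx_absolutely_continuous c e F.
Proof.
move=> ac eb acF i j; have [h1 h2] := acF i j.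
by split; apply: absolutely_continuous_subitv; eassumption.
Qed.

Lemma mx_integrable_sub a b c e m n (F : R -> 'M[R[i]]_(m, n)) :
  a <= c -> e <= b ->
  mx_integrable `]a, b[ F -> mx_integrable `]c, e[ F.
Proof.
move=> ac eb iF i j; have [h1 h2] := iF i j.
by split; [apply: integrableS h1|apply: integrableS h2] => //; apply: subset_itvW.
Qed.

Lemma mx_integrable_restrict a b c e m n (F : R -> 'M[R[i]]_(m, n)) :
  mx_integrable `]a, b[ F ->
  mx_integrable `]a, b[ (fun x => if c < x < e then F x else 0).
Proof.
move=> iF i j.
have hr (h : R -> R) : mu.-integrable `]a, b[ (EFin \o h) ->
    mu.-integrable `]a, b[ (EFin \o (fun x => if c < x < e then h x else 0)).
  move=> ih.
  have -> : EFin \o (fun x => if c < x < e then h x else 0) = (EFin \o h) \_ `]c, e[.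
    by apply/funext => x; rewrite patchE /= mem_setE in_itv /=; case: ifP.
  apply/integrable_restrict => //.
  by apply: integrableS ih => //; exact: measurableI.
have [h1 h2] := iF i j; split; [move: (hr _ h1)|move: (hr _ h2)].
- by congr (mu.-integrable _ _); apply/funext => x /=; case: ifP; rewrite // mxE.
- by congr (mu.-integrable _ _); apply/funext => x /=; case: ifP; rewrite // mxE.
Qed.

Lemma mx_integral_oo c e m n (F : R -> 'M[R[i]]_(m, n)) :
  mx_integrable `]c, e[ F -> mx_integral `[c, e] F = mx_integral `]c, e[ F.
Proof.
move=> iF; apply/matrixP => i j; rewrite !mxE; have [h1 h2] := iF i j.
by rewrite !Rintegral_itv_oo.
Qed.

Lemma mx_FTC a b m n (Y G : R -> 'M[R[i]]_(m, n)) : a <= b ->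
  mx_absolutely_continuous a b Y -> mx_integrable `]a, b[ G ->
  {ae mu, forall x, a < x < b -> is_mx_derive Y x (G x)} ->
  Y b - Y a = mx_integral `[a, b] G.
Proof.
move=> ab acY iG Y'; apply/matrixP => i j; rewrite !mxE.
have [iR iI] := iG i j; have [aR aI] := acY i j.
rewrite -(absolutely_continuous_FTC ab aR iR); last first.
  by apply: ae_imply Y' => x h /h/(_ i j)[].
rewrite -(absolutely_continuous_FTC ab aI iI); last first.
  by apply: ae_imply Y' => x h /h/(_ i j)[].
by case: (Y b i j) (Y a i j) => [p q] [p' q'].
Qed.

Lemma mx_ac_const a b m n (Y : R -> 'M[R[i]]_(m, n)) : a <= b ->
  mx_absolutely_continuous a b Y ->
  {ae mu, forall x, a < x < b -> is_mx_derive Y x 0} -> Y b = Y a.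
Proof.
move=> ab acY Y'; apply/matrixP => i j.
have [aR aI] := acY i j.
have eR : complex.Re (Y b i j) = complex.Re (Y a i j).
  apply: (absolutely_continuous_derive0 ab aR).
  by apply: ae_imply Y' => x h /h/(_ i j)[]; rewrite mxE.
have eI : complex.Im (Y b i j) = complex.Im (Y a i j).
  apply: (absolutely_continuous_derive0 ab aI).
  by apply: ae_imply Y' => x h /h/(_ i j)[]; rewrite mxE.
by move: eR eI; case: (Y b i j) (Y a i j) => [p q] [p' q'] /= -> ->.
Qed.

Lemma mx_ac_diff a b m n (Y1 Y2 : R -> 'M[R[i]]_(m, n)) : a <= b ->
  mx_absolutely_continuous a b Y1 -> mx_absolutely_continuous a b Y2 ->
  {ae mu, forall x, a < x < b ->
     exists2 L, is_mx_derive Y1 x L & is_mx_derive Y2 x L} ->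
  Y1 b - Y1 a = Y2 b - Y2 a.
Proof.
move=> ab ac1 ac2 Y'; apply/matrixP => i j; rewrite !mxE.
have [aR1 aI1] := ac1 i j; have [aR2 aI2] := ac2 i j.
have eR := absolutely_continuous_diff_const ab aR1 aR2.
have eI := absolutely_continuous_diff_const ab aI1 aI2.
move: eR eI.
case: (Y1 b i j) (Y1 a i j) (Y2 b i j) (Y2 a i j)
  => [p1 q1] [p2 q2] [p3 q3] [p4 q4] /= eR eI.
congr (_ +i* _); [apply: eR|apply: eI]; apply: ae_imply Y' => x h /h[L h1 h2].
- by exists (complex.Re (L i j)); [exact: (h1 i j).1|exact: (h2 i j).1].
- by exists (complex.Im (L i j)); [exact: (h1 i j).2|exact: (h2 i j).2].
Qed.

Lemma mx_primitive a b m n (G : R -> 'M[R[i]]_(m, n)) :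
  mx_integrable `]a, b[ G ->
  exists Y, [/\ mx_absolutely_continuous a b Y, Y a = 0 &
    {ae mu, forall x, a < x < b -> is_mx_derive Y x (G x)}].
Proof.
move=> iG.
have /choice[f fP] (k : 'I_m * 'I_n) : exists f : R -> R,
   [/\ absolutely_continuous a b f, f a = 0 &
    {ae mu, forall x, a < x < b -> is_derive x 1 f (complex.Re (G x k.1 k.2))}].
  by have [/ex_primitive[f [? ? _ ?]] _] := iG k.1 k.2; exists f.
have /choice[g gP] (k : 'I_m * 'I_n) : exists f : R -> R,
   [/\ absolutely_continuous a b f, f a = 0 &
    {ae mu, forall x, a < x < b -> is_derive x 1 f (complex.Im (G x k.1 k.2))}].
  by have [_ /ex_primitive[f0 [? ? _ ?]]] := iG k.1 k.2; exists f0.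
exists (fun x => \matrix_(i, j) (f (i, j) x +i* g (i, j) x)); split.
- move=> i j; split.
    have [+ _ _] := fP (i, j); congr absolutely_continuous.
    by apply/funext => x; rewrite mxE.
  have [+ _ _] := gP (i, j); congr absolutely_continuous.
  by apply/funext => x; rewrite mxE.
- apply/matrixP => i j; rewrite !mxE.
  by have [_ -> _] := fP (i, j); have [_ -> _] := gP (i, j).
have : {ae mu, forall x, forall k : 'I_m * 'I_n, a < x < b ->
    is_derive x 1 (f k) (complex.Re (G x k.1 k.2)) /\
    is_derive x 1 (g k) (complex.Im (G x k.1 k.2))}.
  apply: filter_forall => k; have [_ _ h1] := fP k; have [_ _ h2] := gP k.
  by apply: ae_imply2 h1 h2 => x h1 h2 xab; split; [exact: h1|exact: h2].
apply: ae_imply => x h xab i j; have [h1 h2] := h (i, j) xab.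
split; under eq_fun do rewrite mxE; by [].
Qed.
End MatrixFunctions.

(** * Systems of Atkinson type *)

Section AtkinsonSystems.
Local Open Scope classical_set_scope.
Local Open Scope ring_scope.
Local Open Scope sesquilinear_scope.
Local Open Scope complex_scope.

(** The two recursions satisfied by a solution [(y, v)] of the system: [U i] is
    the value of [y] on the cell [[a_i, b_i]] and [V j] the value of [v] on the
    gap [[b_(j-1), a_j]], while [V 0] and [V N.+1] are the values of [v] at the
    ends. *)
Definition recurrence (R : realType) (d N : nat) (tau : discrete_eq R d)
    (l : R[i]) (U V : nat -> 'cV[R[i]]_d) : Prop :=
  (forall j, (j < N)%N -> U j.+1 - U j = dPinv tau j.+1 *m V j.+1) /\
  (forall i, (i <= N)%N -> V i.+1 - V i = (dQ tau i - l *: dW tau i) *m U i).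

Section Atkinson.
Context {R : realType}.
Notation mu := (@lebesgue_measure R).
Variables (d N : nat) (a b : R) (a_ b_ : nat -> R).
Hypothesis hpart : atkinson_partition N a b a_ b_.
Variable w : sl_coeffs R d.
Hypothesis hw : OmegaHat N a b a_ b_ w.

Let tau := discrete_of N a_ b_ w.
Let pot (l : R[i]) (x : R) : 'M[R[i]]_d := slQ w x - l *: slW w x.

Lemma cell_lt i : (i <= N)%N -> a_ i < b_ i.
Proof. by case: hpart => _ _ + _; exact. Qed.

Lemma gap_lt i : (i < N)%N -> b_ i < a_ i.+1.
Proof. by case: hpart => _ _ _; exact. Qed.

Lemma b_lt_a i k : (i < k)%N -> (k <= N)%N -> b_ i < a_ k.
Proof.
elim: k => // k IH; rewrite ltnS leq_eqVlt => /predU1P[->|ik] kN.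
  exact: gap_lt.
apply: lt_trans (IH ik (ltnW kN)) _; apply: lt_trans (gap_lt kN).
exact: cell_lt (ltnW kN).
Qed.

Lemma left_end i : (i <= N)%N -> a <= a_ i.
Proof.
case: hpart => <- _ _ _; case: i => // i iN.
by apply/ltW/(lt_trans (cell_lt (leq0n _))); exact: b_lt_a.
Qed.

Lemma right_end i : (i <= N)%N -> b_ i <= b.
Proof.
case: hpart => _ <- _ _; rewrite leq_eqVlt => /predU1P[->//|iN].
by apply/ltW/(lt_trans (b_lt_a iN (leqnn _))); exact: cell_lt.
Qed.

Lemma partition_cover x n : (n <= N)%N -> a <= x <= b_ n ->
  (exists2 i, (i <= n)%N & a_ i <= x <= b_ i) \/
  (exists2 i, (i < n)%N & b_ i < x < a_ i.+1).
Proof.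
elim: n => [|n IH] nN /andP[ax xb].
  by left; exists 0%N => //; case: hpart => -> _ _ _; rewrite ax.
have [xn|nx] := leP x (b_ n).
  have [|[i iN xi]|[i iN xi]] := IH (ltnW nN); first by rewrite ax.
    by left; exists i => //; exact: leqW.
  by right; exists i => //; exact: leqW.
have [xa|ax'] := ltP x (a_ n.+1); first by right; exists n => //; rewrite nx.
by left; exists n.+1 => //; rewrite ax'.
Qed.

(** At most one of the separated intervals [(c i, e i)] contains [x]. *)
Lemma piecewise_pick n p q (c e : nat -> R) (F : R -> 'M[R[i]]_(p, q))
    (V : nat -> 'cV[R[i]]_q) x j :
  (forall i k, (i < k)%N -> (k < n)%N -> e i <= c k) ->
  (j < n)%N -> c j < x < e j ->
  \sum_(i < n) (if c i < x < e i then F x else 0) *m V i = F x *m V j.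
Proof.
move=> sep jn xj; rewrite (bigD1 (Ordinal jn))//= xj big1 ?addr0// => i ij.
case: ifP => [xi|]; last by rewrite mul0mx.
move: ij; rewrite -val_eqE /= neq_ltn; move: xi xj => /andP[ci ie] /andP[cj je].
case/orP => H; [have := sep _ _ H jn|have := sep _ _ H (ltn_ord i)] => H'.
- by have := lt_trans (lt_le_trans ie H') cj; rewrite ltxx.
- by have := lt_trans (lt_le_trans je H') ci; rewrite ltxx.
Qed.

Lemma piecewise_sum n p q (c e : nat -> R) (F : R -> 'M[R[i]]_(p, q))
    (V : nat -> 'cV[R[i]]_q) x (z : 'cV[R[i]]_q) :
  (forall i k, (i < k)%N -> (k < n)%N -> e i <= c k) ->
  ((forall j, (j < n)%N -> ~~ (c j < x < e j)) -> F x = 0) ->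
  (forall j, (j < n)%N -> c j < x < e j -> z = V j) ->
  F x *m z = \sum_(j < n) (if c j < x < e j then F x else 0) *m V j.
Proof.
move=> sep F0 zV; case: (pickP (fun j : 'I_n => c j < x < e j)) => [j xj|no].
  by rewrite (piecewise_pick _ _ sep (ltn_ord j) xj) -(zV j).
rewrite F0 => [|j jn]; last by rewrite (no (Ordinal jn)).
by rewrite mul0mx big1// => i _; rewrite (no i) mul0mx.
Qed.

Lemma integrable_Pinv : mx_integrable `]a, b[ (slPinv w).
Proof. by case: hw => -[[]]. Qed.

Lemma integrable_Q : mx_integrable `]a, b[ (slQ w).
Proof. by case: hw => -[_ []]. Qed.

Lemma integrable_W : mx_integrable `]a, b[ (slW w).
Proof. by case: hw => -[_ _ []]. Qed.

Lemma Pinv_cell i x : (i <= N)%N -> a < x < b -> a_ i <= x <= b_ i ->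
  slPinv w x = 0.
Proof. by move=> iN xab xi; case: hw => _ [/(_ i iN)[h _] _]; exact: h. Qed.

Lemma pot_gap l j x : (j < N)%N -> a < x < b -> b_ j <= x <= a_ j.+1 ->
  pot l x = 0.
Proof.
move=> jN xab xj; case: hw => _ [_ /(_ j.+1 jN)[hQ hW _]].
by rewrite /pot hQ// hW// scaler0 subrr.
Qed.

Lemma has_integral_itv c e m n (F : R -> 'M[R[i]]_(m, n)) :
  a <= c -> e <= b -> mx_integrable `]a, b[ F ->
  has_integral `]c, e[ F (mx_integral `[c, e] F).
Proof.
move=> ac eb iF; have iF' := mx_integrable_sub ac eb iF.
by apply/has_integralP; split=> //; rewrite mx_integral_oo.
Qed.

Lemma integral_cst0 (I : interval R) :
  mu.-integrable [set` I] (EFin \o (fun=> 0 : R)) /\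
  Rintegral mu [set` I] (fun=> 0 : R) = 0.
Proof.
by split; [exact: integrable0|rewrite /Rintegral integral0].
Qed.

Lemma has_integral_pot l c e : a <= c -> e <= b ->
  has_integral `]c, e[ (pot l)
    (mx_integral `[c, e] (slQ w) - l *: mx_integral `[c, e] (slW w)).
Proof.
move=> ac eb.
have E (M M' : 'M[R[i]]_d) : M - l *: M' = M + M' *m (- l)%:M.
  by rewrite mul_mx_scalar scaleNr.
rewrite E; have -> : pot l = (fun x => slQ w x + slW w x *m (- l)%:M).
  by apply/funext => x; exact: E.
apply: mx_relD; first exact: lin_integral.
  exact: has_integral_itv integrable_Q.
apply: mx_rel_mulr; [exact: lin_integral|exact: integral_cst0|].
exact: has_integral_itv integrable_W.
Qed.

Lemma has_integral_gap j : (j < N)%N ->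
  has_integral `]b_ j, a_ j.+1[ (slPinv w) (dPinv tau j.+1).
Proof.
move=> jN; rewrite /= jN; apply: has_integral_itv integrable_Pinv.
  exact: le_trans (left_end (ltnW jN)) (ltW (cell_lt (ltnW jN))).
exact: le_trans (ltW (cell_lt jN)) (right_end jN).
Qed.

Lemma has_integral_cell l i : (i <= N)%N ->
  has_integral `]a_ i, b_ i[ (pot l) (dQ tau i - l *: dW tau i).
Proof. by move=> iN; apply: has_integral_pot; [exact: left_end|exact: right_end]. Qed.

Lemma mx_FTC_has_integral c e m n (Y G : R -> 'M[R[i]]_(m, n)) L : a <= c -> c <= e -> e <= b ->
  mx_absolutely_continuous a b Y -> has_integral `]c, e[ G L ->
  {ae mu, forall x, c < x < e -> is_mx_derive Y x (G x)} ->
  Y e - Y c = L.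
Proof.
move=> ac ce eb acY /has_integralP[iG <-] Y'.
rewrite (mx_FTC ce (mx_ac_sub ac eb acY) iG Y') mx_integral_oo//.
Qed.

(* [P^-1] cut down to one gap, and [Q - l W] cut down to one cell. *)
Let gapc j x : 'M[R[i]]_d := if b_ j < x < a_ j.+1 then slPinv w x else 0.
Let cellc l i x : 'M[R[i]]_d := if a_ i < x < b_ i then pot l x else 0.

Lemma gap_sep i k : (i < k)%N -> (k < N)%N -> a_ i.+1 <= b_ k.
Proof.
move=> ik kN; have iN := leq_trans ik (ltnW kN).
move: ik; rewrite leq_eqVlt => /predU1P[<-|ik]; first exact/ltW/cell_lt.
apply: le_trans (ltW (cell_lt iN)) _; apply: le_trans (ltW (b_lt_a ik (ltnW kN))) _.
exact/ltW/cell_lt/ltnW.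
Qed.

Lemma cell_sep i k : (i < k)%N -> (k < N.+1)%N -> b_ i <= a_ k.
Proof. by move=> ik kN; apply/ltW/b_lt_a. Qed.

(** [P^-1] vanishes outside the gaps, so its product with [v] only involves the
    values of [v] there. *)
Lemma gap_sum (V : nat -> 'cV[R[i]]_d) x z : a < x < b ->
  (forall j, (j < N)%N -> b_ j < x < a_ j.+1 -> z = V j.+1) ->
  slPinv w x *m z = \sum_(j < N) gapc j x *m V j.+1.
Proof.
move=> xab zV; apply: (piecewise_sum (V := fun j => V j.+1) gap_sep) => // no.
have axb : a <= x <= b_ N.
  by case: hpart => _ -> _ _; move/andP: xab => [/ltW -> /ltW ->].
have [[i iN xi]|[i iN xi]] := partition_cover (leqnn N) axb.
- exact: Pinv_cell xi.
- by have := no i iN; rewrite xi.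
Qed.

Lemma cell_sum l (U : nat -> 'cV[R[i]]_d) x z : a < x < b ->
  (forall i, (i <= N)%N -> a_ i < x < b_ i -> z = U i) ->
  pot l x *m z = \sum_(i < N.+1) cellc l i x *m U i.
Proof.
move=> xab zU; apply: (piecewise_sum cell_sep) => // no.
have axb : a <= x <= b_ N.
  by case: hpart => _ -> _ _; move/andP: xab => [/ltW -> /ltW ->].
have [[i iN /andP[]]|[i iN xi]] := partition_cover (leqnn N) axb.
- rewrite le_eqVlt => /predU1P[xE|ax]; rewrite le_eqVlt => /predU1P[xE'|xb].
  + by have := cell_lt iN; rewrite xE -xE' ltxx.
  + case: i iN xE xb => [|i] iN xE _.
      by case: hpart xab => <- _ _ _; rewrite xE ltxx.
    by apply: (pot_gap l iN xab); rewrite -xE lexx andbT ltW// gap_lt.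
  + move: iN; rewrite leq_eqVlt => /predU1P[iE|iN].
      by case: hpart xab => _ <- _ _; rewrite xE' iE ltxx andbF.
    by apply: (pot_gap l iN xab); rewrite xE' lexx ltW// gap_lt.
  + by have := no i iN; rewrite ax xb.
- by apply: (pot_gap l iN xab); case/andP: xi => /ltW -> /ltW ->.
Qed.

(** On a cell [P^-1] vanishes and [y] is constant; on a gap [v] can be replaced by
    a constant vector and [y] grows by an integral of [P^-1]. *)
Lemma gap_increments (y : R -> 'cV[R[i]]_d) (V : nat -> 'cV[R[i]]_d) :
  mx_absolutely_continuous a b y ->
  {ae mu, forall x, a < x < b ->
     is_mx_derive y x (\sum_(j < N) gapc j x *m V j.+1)} ->
  (forall i x, (i <= N)%N -> a_ i <= x <= b_ i -> y x = y (a_ i)) /\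
  (forall j, (j < N)%N -> y (a_ j.+1) - y (b_ j) = dPinv tau j.+1 *m V j.+1).
Proof.
move=> acy y'; split=> [i x iN /andP[ax xb]|j jN].
  have xb' := le_trans xb (right_end iN); have ax' := left_end iN.
  apply: (mx_ac_const ax (mx_ac_sub ax' xb' acy)).
  apply: ae_imply y' => t h /andP[at_ tx].
  have tab : a < t < b.
    by rewrite (le_lt_trans ax' at_) (lt_le_trans tx xb').
  have -> // : 0 = \sum_(j < N) gapc j t *m V j.+1; last exact: h.
  rewrite big1// => j _; rewrite /gapc (Pinv_cell iN tab) ?if_same ?mul0mx//.
  by rewrite (ltW at_) (ltW (lt_le_trans tx xb)).
have ab' : a <= b_ j := le_trans (left_end (ltnW jN)) (ltW (cell_lt (ltnW jN))).
have ab'' : a_ j.+1 <= b := le_trans (ltW (cell_lt jN)) (right_end jN).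
apply: (@mx_FTC_has_integral _ _ _ _ _ (fun x => slPinv w x *m V j.+1) _ ab'
          (ltW (gap_lt jN)) ab'' acy).
  apply: mx_rel_mulr; [exact: lin_integral|exact: integral_cst0|].
  exact: has_integral_gap.
apply: ae_imply y' => t h tj.
have tab : a < t < b.
  by case/andP: tj => /(le_lt_trans ab') -> /lt_le_trans ->.
have := h tab; rewrite -(piecewise_pick (slPinv w) (fun j => V j.+1) gap_sep jN tj).
by [].
Qed.

Lemma cell_increments l (v : R -> 'cV[R[i]]_d) (U : nat -> 'cV[R[i]]_d) :
  mx_absolutely_continuous a b v ->
  {ae mu, forall x, a < x < b ->
     is_mx_derive v x (\sum_(i < N.+1) cellc l i x *m U i)} ->
  (forall j x, (j < N)%N -> b_ j <= x <= a_ j.+1 -> v x = v (b_ j)) /\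
  (forall i, (i <= N)%N ->
     v (b_ i) - v (a_ i) = (dQ tau i - l *: dW tau i) *m U i).
Proof.
move=> acv v'; split=> [j x jN /andP[bx xa]|i iN].
  have ab' : a <= b_ j := le_trans (left_end (ltnW jN)) (ltW (cell_lt (ltnW jN))).
  have ab'' : x <= b := le_trans xa (le_trans (ltW (cell_lt jN)) (right_end jN)).
  apply: (mx_ac_const bx (mx_ac_sub ab' ab'' acv)).
  apply: ae_imply v' => t h /andP[bt tx].
  have tab : a < t < b by rewrite (le_lt_trans ab' bt) (lt_le_trans tx ab'').
  have -> // : 0 = \sum_(i < N.+1) cellc l i t *m U i; last exact: h.
  rewrite big1// => i _; rewrite /cellc (pot_gap l jN tab) ?if_same ?mul0mx//.
  by rewrite (ltW bt) (ltW (lt_le_trans tx xa)).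
have ab' := left_end iN; have ab'' := right_end iN.
apply: (@mx_FTC_has_integral _ _ _ _ _ (fun x => pot l x *m U i) _ ab'
          (ltW (cell_lt iN)) ab'' acv).
  apply: mx_rel_mulr; [exact: lin_integral|exact: integral_cst0|].
  exact: has_integral_cell.
apply: ae_imply v' => t h ti.
have tab : a < t < b.
  by case/andP: ti => /(le_lt_trans ab') -> /lt_le_trans ->.
have iN' : (i < N.+1)%N by [].
by have := h tab; rewrite -(piecewise_pick (pot l) U cell_sep iN' ti).
Qed.

Let is_gap_primitive (Yp : nat -> R -> 'M[R[i]]_d) : Prop := forall j,
  [/\ mx_absolutely_continuous a b (Yp j), Yp j a = 0 &
    {ae mu, forall x, a < x < b -> is_mx_derive (Yp j) x (gapc j x)}].

Lemma ex_gap_primitive : exists Yp, is_gap_primitive Yp.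
Proof.
have /choice[Yp YpP] (j : nat) : exists Y, [/\ mx_absolutely_continuous a b Y,
    Y a = 0 & {ae mu, forall x, a < x < b -> is_mx_derive Y x (gapc j x)}].
  apply: mx_primitive; exact/mx_integrable_restrict/integrable_Pinv.
by exists Yp.
Qed.

Lemma ex_cell_primitive l : exists Zp : nat -> R -> 'M[R[i]]_d, forall i,
  [/\ mx_absolutely_continuous a b (Zp i), Zp i a = 0 &
    {ae mu, forall x, a < x < b -> is_mx_derive (Zp i) x (cellc l i x)}].
Proof.
have /choice[Zp ZpP] (i : nat) : exists Y, [/\ mx_absolutely_continuous a b Y,
    Y a = 0 & {ae mu, forall x, a < x < b -> is_mx_derive Y x (cellc l i x)}].
  apply: mx_primitive; apply: mx_integrable_restrict.
  by have /has_integralP[] := has_integral_pot l (lexx a) (lexx b).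
by exists Zp.
Qed.

Lemma primitive_sum k (Yp C : nat -> R -> 'M[R[i]]_d) (U : 'cV[R[i]]_d)
    (V : nat -> 'cV[R[i]]_d) :
  (forall j, [/\ mx_absolutely_continuous a b (Yp j), Yp j a = 0 &
    {ae mu, forall x, a < x < b -> is_mx_derive (Yp j) x (C j x)}]) ->
  let y x := U + \sum_(j < k) Yp j x *m V j in
  [/\ mx_absolutely_continuous a b y, y a = U &
    {ae mu, forall x, a < x < b -> is_mx_derive y x (\sum_(j < k) C j x *m V j)}].
Proof.
move=> YpP y; split.
- have : mx_rel (fun f _ => absolutely_continuous a b f) y (0 + \sum_(j < k) 0 *m V j).
    apply: mx_relD; first exact: lin_absolutely_continuous.
      by move=> i j; split; exact: ac_cst.
    apply: mx_rel_sum; [exact: lin_absolutely_continuous|exact: ac_cst|] => j.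
    apply: mx_rel_mulr; [exact: lin_absolutely_continuous|exact: ac_cst|].
    by have [h _ _] := YpP j; move=> p q; exact: h.
  by move=> h i j; exact: h.
- by rewrite /y big1 ?addr0// => j _; have [_ -> _] := YpP j; rewrite mul0mx.
have : {ae mu, forall x, forall j : 'I_k, a < x < b -> is_mx_derive (Yp j) x (C j x)}.
  by apply: filter_forall => j; have [_ _] := YpP j.
apply: ae_imply => x h xab.
have D0 (c : R) : is_derive x 1 (fun=> c) 0 by exact: is_derive_cst.
rewrite -[X in is_mx_derive _ _ X]add0r.
apply: (mx_relD (Q := fun f l => is_derive x 1 f l)); first exact: lin_derive.
  by move=> i j; rewrite mxE; split; exact: D0.
apply: (mx_rel_sum (Q := fun f l => is_derive x 1 f l)); [exact: lin_derive|exact: D0|].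
move=> j; apply: (mx_rel_mulr (Q := fun f l => is_derive x 1 f l));
  [exact: lin_derive|exact: D0|].
exact: h.
Qed.

(** The primitives of [P^-1] cut down to the gaps turn a solution of the
    recursions into a function on the whole interval. They are chosen once and
    for all, so that this extension is linear in [U] and [V]. *)
Section Extension.
Variable Yp : nat -> R -> 'M[R[i]]_d.
Hypothesis YpP : is_gap_primitive Yp.

Let ext (U V : nat -> 'cV[R[i]]_d) (x : R) : 'cV[R[i]]_d :=
  U 0%N + \sum_(j < N) Yp j x *m V j.+1.

(** Here [U i] is the value at [a_i], and [V j.+1] the value at [b_j]. The function
    [y] and the extension have the same derivative almost everywhere and the same
    value at [a]. *)
Lemma sl_system_recurrence l (y v : R -> 'cV[R[i]]_d) :
  sl_system a b w l y v -> exists U V : nat -> 'cV[R[i]]_d,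
  [/\ recurrence N tau l U V, forall i, (i <= N)%N -> y (a_ i) = U i,
      [/\ y b = U N, v a = V 0%N & v b = V N.+1] &
      forall x, a <= x <= b -> y x = ext U V x].
Proof.
move=> [acy acv sys].
have ycst i x : (i <= N)%N -> a_ i <= x <= b_ i -> y x = y (a_ i).
  move=> iN /andP[ax xb].
  have xb' := le_trans xb (right_end iN); have ax' := left_end iN.
  apply: (mx_ac_const ax (mx_ac_sub ax' xb' acy)).
  apply: ae_imply sys => t h /andP[at_ tx].
  have tab : a < t < b by rewrite (le_lt_trans ax' at_) (lt_le_trans tx xb').
  have [+ _] := h tab; rewrite (Pinv_cell iN tab) ?mul0mx//.
  by rewrite (ltW at_) (ltW (lt_le_trans tx xb)).
have vcst j x : (j < N)%N -> b_ j <= x <= a_ j.+1 -> v x = v (b_ j).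
  move=> jN /andP[bx xa].
  have ab' : a <= b_ j := le_trans (left_end (ltnW jN)) (ltW (cell_lt (ltnW jN))).
  have ab'' : x <= b := le_trans xa (le_trans (ltW (cell_lt jN)) (right_end jN)).
  apply: (mx_ac_const bx (mx_ac_sub ab' ab'' acv)).
  apply: ae_imply sys => t h /andP[bt tx].
  have tab : a < t < b by rewrite (le_lt_trans ab' bt) (lt_le_trans tx ab'').
  have [_] := h tab; rewrite -/(pot l t) (pot_gap l jN tab) ?mul0mx//.
  by rewrite (ltW bt) (ltW (lt_le_trans tx xa)).
pose U i := y (a_ i); pose V j := if j is j'.+1 then v (b_ j') else v a.
have y' : {ae mu, forall x, a < x < b ->
    is_mx_derive y x (\sum_(j < N) gapc j x *m V j.+1)}.
  apply: ae_imply sys => x h xab; have [+ _] := h xab.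
  rewrite (gap_sum (V := V) xab)// => j jN /andP[bx xa].
  by rewrite (vcst j)// (ltW bx) (ltW xa).
have v' : {ae mu, forall x, a < x < b ->
    is_mx_derive v x (\sum_(i < N.+1) cellc l i x *m U i)}.
  apply: ae_imply sys => x h xab; have [_] := h xab.
  rewrite -/(pot l x) (cell_sum (U := U) l xab)// => i iN /andP[ax xb].
  by rewrite (ycst i)// (ltW ax) (ltW xb).
have [_ iy] := gap_increments acy y'; have [_ iv] := cell_increments acv v'.
have yb i : (i <= N)%N -> y (b_ i) = U i.
  by move=> iN; rewrite (ycst i)// lexx ltW// cell_lt.
have va i : (i <= N)%N -> v (a_ i) = V i.
  case: i => [_|i iN]; first by case: hpart => ->.
  by rewrite (vcst i)// lexx ltW// gap_lt.
have bN : b_ N = b by case: hpart.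
have a0 : a_ 0%N = a by case: hpart.
exists U, V; split=> //.
- split=> [j jN|i iN]; first by rewrite -(yb j (ltnW jN)); exact: (iy j jN).
  by rewrite -(va i iN); exact: (iv i iN).
- by split; rewrite /V ?bN//; have := yb N (leqnn N); rewrite bN.
- move=> x /andP[ax xb].
  have [ace exta ext'] := primitive_sum N (U 0%N) (fun j => V j.+1) YpP.
  have : y x - y a = ext U V x - ext U V a.
    apply: (mx_ac_diff ax (mx_ac_sub (lexx a) xb acy) (mx_ac_sub (lexx a) xb ace)).
    apply: ae_imply2 y' ext' => t h1 h2 /andP[at_ tx].
    have tab : a < t < b by rewrite at_ (lt_le_trans tx xb).
    by exists (\sum_(j < N) gapc j t *m V j.+1); [exact: h1|exact: h2].
  have -> : ext U V a = y a by rewrite /ext exta /U a0.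
  by move/addIr.
Qed.

(** By construction the derivative of the extension is [P^-1] times the step
    function of the [V j], and [v] is built in the same way from the [U i]. The
    recursions show, from left to right, that these step functions agree with [v]
    on the gaps and with the extension on the cells. *)
Lemma recurrence_sl_system l (U V : nat -> 'cV[R[i]]_d) : recurrence N tau l U V ->
  exists v, [/\ sl_system a b w l (ext U V) v,
    forall i, (i <= N)%N -> ext U V (a_ i) = U i &
    [/\ ext U V b = U N, v a = V 0%N & v b = V N.+1]].
Proof.
move=> [recU recV]; have [Zp ZpP] := ex_cell_primitive l.
have [acy ya y'] := primitive_sum N (U 0%N) (fun j => V j.+1) YpP.
have [acv va v'] := primitive_sum N.+1 (V 0%N) U ZpP.
rewrite -/(ext U V) in acy ya y'; set y := ext U V in acy ya y' *.
set v := (fun x => V 0%N + _) in acv va v'.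
have [ycst iy] := gap_increments acy y'; have [vcst iv] := cell_increments acv v'.
have bN : b_ N = b by case: hpart.
have a0 : a_ 0%N = a by case: hpart.
have yb i : (i <= N)%N -> y (b_ i) = y (a_ i).
  by move=> iN; rewrite (ycst i)// lexx ltW// cell_lt.
have yU i : (i <= N)%N -> y (a_ i) = U i.
  elim: i => [_|i IH iN]; first by rewrite a0.
  apply: (addIr (- U i)); rewrite recU// -iy//; congr (_ - _).
  by rewrite yb ?IH// ltnW.
have vb i : (i <= N)%N -> v (a_ i) = V i -> v (b_ i) = V i.+1.
  by move=> iN vi; apply: (addIr (- V i)); rewrite recV// -iv// vi.
have vV i : (i <= N)%N -> v (a_ i) = V i.
  elim: i => [_|i IH iN]; first by rewrite a0.
  rewrite (vcst i) ?lexx ?andbT ?(ltW (gap_lt iN))//.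
  by apply: vb; [exact: ltnW|apply: IH; exact: ltnW].
exists v; split=> //.
- split=> //; apply: ae_imply2 y' v' => x hy hv xab; split.
    rewrite (gap_sum (V := V) xab); first exact: hy.
    move=> j jN /andP[bx xa]; rewrite (vcst j) ?(ltW bx) ?(ltW xa)//.
    by apply: vb; [exact: ltnW|apply: vV; exact: ltnW].
  rewrite -/(pot l x) (cell_sum (U := U) l xab); first exact: hv.
  by move=> i iN /andP[ax xb]; rewrite (ycst i) ?(ltW ax) ?(ltW xb)// yU.
- split=> //; first by rewrite -bN yb// yU.
  by rewrite -bN; apply: vb => //; exact: vV.
Qed.
End Extension.
End Atkinson.
End AtkinsonSystems.

(** * The correspondence of solutions *)

Section SolutionCorrespondence.
Local Open Scope classical_set_scope.
Local Open Scope ring_scope.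
Local Open Scope sesquilinear_scope.
Local Open Scope complex_scope.

Lemma hermitian_integral (R : realType) d (a b c e : R) (F : R -> 'M[R[i]]_d) :
  a <= c -> e <= b -> hermitian_integrable a b F ->
  (mx_integral `[c, e] F)^t* = mx_integral `[c, e] F.
Proof.
move=> ac eb [iF hF].
have /(mx_rel_adj (@lin_integral _ _)) := has_integral_itv ac eb iF.
move=> /has_integralP[_ <-].
rewrite mx_integral_oo; last exact: mx_integrable_sub iF.
have FE x : x \in `]c, e[%classic -> (F x)^t* = F x.
  rewrite inE /= in_itv /= => /andP[cx xe]; apply/hermmxP/hF.
  by rewrite (le_lt_trans ac cx) (lt_le_trans xe eb).
apply/matrixP => i j; rewrite !mxE.
by congr (_ +i* _); apply: eq_Rintegral => x xce; rewrite FE.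
Qed.

(** The two forms of the boundary condition differ only by [u_0] being written as
    [u_(-1) + Delta u_(-1)]. *)
Lemma shift_boundary (C : nzRingType) m n (A1 A2 B1 B2 : 'M[C]_(m, n))
    (x y z t : 'cV[C]_n) :
  row_mx A1 A2 *m col_mx (- x) z + row_mx B1 B2 *m col_mx (x - y) t =
  row_mx A1 A2 *m col_mx (- y) z + row_mx (B1 - A1) B2 *m col_mx (x - y) t.
Proof.
rewrite !mul_row_col mulmxBl (mulmxBr A1) !mulmxN opprB addrACA [RHS]addrACA.
by congr (_ + _); rewrite addrCA addKr addrC.
Qed.

Lemma discrete_problem_shift (R : realType) (d N : nat) (tau : discrete_eq R d)
    (A1 A2 B1 B2 : 'M[R[i]]_(d + d, d)) :
  discrete_problem0 N tau (bc_class (row_mx A1 A2) (row_mx B1 B2)) =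
  discrete_problem1 N tau (bc_class (row_mx A1 A2) (row_mx (B1 - A1) B2)).
Proof.
congr EigenProblem; apply/funext => l; apply/seteqP.
have E (u : int -> 'cV[R[i]]_d) := shift_boundary A1 A2 B1 B2 (u 0) (u (-1))
  (u N%:Z) (Delta u N%:Z).
split=> u [su /bc_holdsP bc]; split=> //; apply/bc_holdsP.
  by rewrite -[RHS]bc; exact/esym/E.
by rewrite -[RHS]bc; exact: E.
Qed.

Lemma lincomb_residual (C : nzRingType) (V : lmodType C) (c : C)
    (m m' x n n' y : V) :
  m - m' + x = 0 -> n - n' + y = 0 ->
  c *: m + n - (c *: m' + n') + (c *: x + y) = 0.
Proof.
move=> h1 h2; rewrite opprD [X in X + _]addrACA -scalerBr addrACA -scalerDr.
by rewrite h1 h2 scaler0 addr0.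
Qed.

Lemma lincomb_boundary (C : comNzRingType) m n (A B : 'M[C]_(m, n)) (c : C)
    (p q p' q' : 'cV[C]_n) :
  A *m p + B *m q = 0 -> A *m p' + B *m q' = 0 ->
  A *m (c *: p + p') + B *m (c *: q + q') = 0.
Proof.
move=> h1 h2; rewrite !mulmxDr -!scalemxAr addrACA -scalerDr h1 h2.
by rewrite scaler0 addr0.
Qed.

Lemma lincomb_sum (C : comNzRingType) k m n (Y : 'I_k -> 'M[C]_(m, n))
    (V W : 'I_k -> 'cV[C]_n) u v (c : C) :
  c *: u + v + \sum_j Y j *m (c *: V j + W j) =
  c *: (u + \sum_j Y j *m V j) + (v + \sum_j Y j *m W j).
Proof.
under eq_bigr do rewrite mulmxDr -scalemxAr.
by rewrite big_split/= -scaler_sumr addrACA -scalerDr.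
Qed.

Section DiscreteLinear.
Variables (R : realType) (d N : nat) (tau : discrete_eq R d).

Lemma Delta_linear c (u v : int -> 'cV[R[i]]_d) k :
  Delta (c *: u + v) k = c *: Delta u k + Delta v k.
Proof.
have E h : (c *: u + v) h = c *: u h + v h by [].
by rewrite /Delta !E scalerBr opprD addrACA.
Qed.

Lemma momentum_linear c (u v : int -> 'cV[R[i]]_d) j :
  momentum tau (c *: u + v) j = c *: momentum tau u j + momentum tau v j.
Proof. by rewrite /momentum Delta_linear mulmxDr scalemxAr. Qed.

Lemma discrete_problem_linear A B l c (u v : int -> 'cV[R[i]]_d) :
  let p := discrete_problem0 N tau (bc_class A B) in
  sol p l u -> sol p l v -> sol p l (c *: u + v).
Proof.
move=> p [/discrete_solutionE su /bc_holdsP bu] [/discrete_solutionE sv /bc_holdsP bv].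
have E k : (c *: u + v) k = c *: u k + v k by [].
split.
  apply/discrete_solutionE => i iN; rewrite !momentum_linear E mulmxDr -scalemxAr.
  exact: lincomb_residual (su i iN) (sv i iN).
apply/bc_holdsP.
have := lincomb_boundary c bu bv; rewrite !Delta_linear !E.
by rewrite !scale_col_mx !add_col_mx scalerN opprD.
Qed.

Lemma discrete_problem_zero A B l :
  sol (discrete_problem0 N tau (bc_class A B)) l 0.
Proof.
have D0 k : Delta (0 : int -> 'cV[R[i]]_d) k = 0 by rewrite /Delta subrr.
split; first by apply/discrete_solutionE => i iN; rewrite /momentum !D0 !mulmx0 subrr addr0.
by apply/bc_holdsP; rewrite !D0 oppr0 !col_mx0 !mulmx0 addr0.
Qed.

Lemma discrete_recurrence l (u : int -> 'cV[R[i]]_d) :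
  (forall j, (j < N)%N -> dPinv tau j.+1 \in unitmx) ->
  discrete_solution N tau l u ->
  recurrence N tau l (fun i => u i%:Z) (momentum tau u).
Proof.
move=> Pu /discrete_solutionE su; split=> [j jN|i iN].
  by rewrite momentumS mulKVmx// Pu.
have /eqP := su i iN; rewrite addrC addr_eq0 opprB => /eqP; exact: esym.
Qed.

(** The values at [-1] and [N + 1] are chosen to fit [V 0] and [V N.+1]. *)
Lemma recurrence_discrete l (U V : nat -> 'cV[R[i]]_d) :
  dPinv tau 0 = 1%:M -> dPinv tau N.+1 = 1%:M ->
  (forall j, (j < N)%N -> dPinv tau j.+1 \in unitmx) ->
  recurrence N tau l U V -> exists u, [/\ discrete_solution N tau l u,
    forall i, (i <= N)%N -> u i%:Z = U i &
    forall j, (j <= N.+1)%N -> momentum tau u j = V j].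
Proof.
move=> P0 PN Pu [recU recV].
pose u (k : int) : 'cV[R[i]]_d := match k with
  | Posz i => if (i <= N)%N then U i else U N + V N.+1
  | Negz _ => U 0%N - V 0%N end.
have uU i : (i <= N)%N -> u i%:Z = U i by rewrite /u => ->.
have D0 : Delta u (-1) = V 0%N.
  have -> : Delta u (-1) = U 0%N - (U 0%N - V 0%N) by [].
  by rewrite opprB addrC subrK.
have DN : Delta u N%:Z = V N.+1.
  rewrite /Delta uU//; have -> : N%:Z + 1 = N.+1%:Z by rewrite -PoszD addn1.
  by rewrite /u ltnn addrC addKr.
have mV j : (j <= N.+1)%N -> momentum tau u j = V j.
  case: j => [_|j]; first by rewrite momentum0.
  rewrite ltnS leq_eqVlt => /predU1P[->|jN]; first by rewrite momentum_last.
  by rewrite momentumS (uU j.+1 jN) (uU j (ltnW jN)) recU// mulKmx// Pu.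
exists u; split=> //; apply/discrete_solutionE => i iN.
rewrite (mV i.+1 (iN : (i.+1 <= N.+1)%N)) (mV i (leqW iN)) (uU i iN) -(recV i iN).
by rewrite addrA subrK subrr.
Qed.

(** The first and the last equation determine the values at [-1] and [N + 1]. *)
Lemma discrete_solution_eq0 l (u : int -> 'cV[R[i]]_d) : (0 < N)%N ->
  dPinv tau 0 = 1%:M -> dPinv tau N.+1 = 1%:M ->
  discrete_solution N tau l u -> (forall i, (i <= N)%N -> u i%:Z = 0) ->
  forall k, discrete_dom N k -> u k = 0.
Proof.
move=> N0 P0 PN /discrete_solutionE su u0.
have m0 j : (j < N)%N -> momentum tau u j.+1 = 0.
  by move=> jN; rewrite momentumS !u0 ?subrr ?mulmx0// ltnW.
rewrite /discrete_dom /=; case=> [k|[|k]].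
- case: (leqP k N) => kN; first by rewrite u0.
  move=> hk; have -> : k = N.+1.
    by apply/eqP; rewrite eqn_leq kN andbT; move: hk; rewrite -PoszD lez_nat addn1.
  have := su N (leqnn _); rewrite momentum_last// u0// mulmx0 addr0.
  rewrite -{1}(prednK N0) m0 ?prednK// sub0r => /eqP; rewrite oppr_eq0 /Delta.
  have -> : N%:Z + 1 = N.+1%:Z by rewrite -PoszD addn1.
  by rewrite (u0 N (leqnn N)) subr0 => /eqP.
- move=> _; have := su 0%N (leq0n _).
  rewrite momentum0// u0// mulmx0 addr0 m0// subr0.
  have -> : Delta u (-1) = u 0%N - u (-1) by [].
  by rewrite u0// sub0r => /eqP; rewrite oppr_eq0 => /eqP.
- by move=> /andP[].
Qed.
End DiscreteLinear.

Section Correspondence.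
Variables (R : realType) (d N : nat) (a b : R) (a_ b_ : nat -> R).
Hypothesis hpart : atkinson_partition N a b a_ b_.
Variable w : sl_coeffs R d.
Hypothesis hw : OmegaHat N a b a_ b_ w.

(** The correspondence sends a discrete solution to the extension of its values
    and momenta. *)
Lemma indep_sizes_sl A B l : (0 < N)%N ->
  indep_sizes (sl_problem a b w (bc_class A B)) l =
  indep_sizes (discrete_problem0 N (discrete_of N a_ b_ w) (bc_class A B)) l.
Proof.
move=> N0; have a0 : a_ 0%N = a by case: hpart.
have [Yp YpP] := ex_gap_primitive hw.
(* The recursions are all that is used of [tau] below; forgetting its definition
   keeps unification from unfolding the integrals. *)
have fwd := sl_system_recurrence hpart hw YpP.
have bwd := recurrence_sl_system hpart hw YpP.
have Pu j : (j < N)%N -> dPinv (discrete_of N a_ b_ w) j.+1 \in unitmx.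
  by move=> jN; case: hw => _ [_ /(_ j.+1 jN)[_ _]]; rewrite /= jN.
have P0 : dPinv (discrete_of N a_ b_ w) 0 = 1%:M by [].
have PN : dPinv (discrete_of N a_ b_ w) N.+1 = 1%:M by rewrite /= ltnn.
move: (discrete_of N a_ b_ w) fwd bwd Pu P0 PN => tau fwd bwd Pu P0 PN.
pose L (u : int -> 'cV[R[i]]_d) x :=
  u 0%N + \sum_(j < N) Yp j x *m momentum tau u j.+1.
have L_at u l' i : discrete_solution N tau l' u -> (i <= N)%N -> L u (a_ i) = u i%:Z.
  move=> su iN; have [v [_ h _]] := bwd _ _ _ (discrete_recurrence Pu su).
  exact: h i iN.
apply: (@indep_sizes_inj _ _ _ _ _ _ _ _ L).
- move=> c u v; apply/funext => x; apply: etrans (lincomb_sum _ _ _ _ _ _).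
  congr (_ + _); apply: eq_bigr => j _; congr (_ *m _).
  exact: momentum_linear.
- exact: discrete_problem_zero.
- by move=> c u v; exact: discrete_problem_linear.
- move=> y [v sys /bc_holdsP bc].
  have [U [V [rec yU [yb va vb] yE]]] := fwd _ _ _ sys.
  have [u [su uU mV]] := recurrence_discrete P0 PN Pu rec.
  exists u.
    split=> //; apply/bc_holdsP.
    rewrite -(momentum0 u P0) -(momentum_last u PN) (mV 0%N)// (mV N.+1)//.
    by rewrite (uU 0%N (leq0n N)) (uU N (leqnn N)) -va -vb -yb -(yU 0%N (leq0n N)) a0.
  move=> x; rewrite /= in_itv /= => xab.
  rewrite (yE x xab) /L (uU 0%N (leq0n N)); congr (_ + _).
  by apply: eq_bigr => j _; rewrite (mV j.+1)// ltnS ltnW.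
- move=> u [su /bc_holdsP bc].
  have [v [sys _ [extb va vb]]] := bwd _ _ _ (discrete_recurrence Pu su).
  exists v; first exact: sys.
  apply/bc_holdsP; rewrite va vb momentum0// momentum_last//.
  have -> : L u b = u N%:Z by exact: extb.
  by have -> : L u a = u 0 by rewrite -a0; exact: (L_at u l 0%N).
- move=> u [su _]; split=> [Lu|u0 x].
    apply: (discrete_solution_eq0 N0 P0 PN su) => i iN.
    rewrite -(L_at u l i su iN); apply: Lu; rewrite /= in_itv /= (left_end hpart iN).
    exact: le_trans (ltW (cell_lt hpart iN)) (right_end hpart iN).
  move=> _; have {}u0 i : (i <= N)%N -> u i%:Z = 0.
    move=> iN; apply: u0; rewrite /= /discrete_dom /= -PoszD lez_nat addn1.
    exact: leqW.
  rewrite /L u0// add0r big1// => j _.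
  by rewrite momentumS (u0 j.+1 (ltn_ord j)) (u0 j (ltnW (ltn_ord j))) subrr !mulmx0.
Qed.
End Correspondence.
End SolutionCorrespondence.

Local Open Scope ring_scope.
Local Open Scope complex_scope.

Theorem lemma5p2 (R : realType) (d N : nat) (hd : (1 <= d)%N) (hN : (1 < N)%N)
    (a b : R) (a_ b_ : nat -> R) (hpart : atkinson_partition N a b a_ b_)
    (w : sl_coeffs R d) (hw : OmegaHat N a b a_ b_ w)
    (A1 A2 B1 B2 : 'M[R[i]]_(d + d, d))
    (hA : BC (bc_class (row_mx A1 A2) (row_mx B1 B2))) :
  let AA := bc_class (row_mx A1 A2) (row_mx B1 B2) in
  let CC := bc_class (row_mx A1 A2) (row_mx (B1 - A1) B2) in
  let tau := discrete_of N a_ b_ w in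
  [/\ spectrum (sl_problem a b w AA) = spectrum (discrete_problem0 N tau AA),
      forall l : R[i], multiplicity (sl_problem a b w AA) l =
                       multiplicity (discrete_problem0 N tau AA) l,
      discrete_problem0 N tau AA = discrete_problem1 N tau CC &
      [/\ sharp1 (sl_problem a b w AA) = sharp1 (discrete_problem0 N tau AA),
          sharp1 (discrete_problem0 N tau AA)
            = sharp1 (discrete_problem1 N tau CC) &
          sharp1 (discrete_problem1 N tau CC)
            = (((N - 1) * d + \rank (row_mx B1 B2))%N%:R)%:E]].
Proof.
move=> AA CC tau.
have N0 : (0 < N)%N by exact: ltnW.
have same l := indep_sizes_sl hpart hw (row_mx A1 A2) (row_mx B1 B2) l N0.
have [rk sa] := (BC_classP _ _).1 hA.
have [[hP hQ hW] _] := hw.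
have [D Dl] : exists D : 'rV[R[i]]_((N - 1) * d + \rank (row_mx B1 B2)), forall l,
    indep_sizes (discrete_problem0 N tau AA) l = [set k | (k <= diag_mult D l)%N]%classic.
  apply: discrete_diagonalizable => //.
  - by rewrite /= ltnn.
  - move=> j jN; rewrite /= jN.
    case: j jN => // j jN; apply: hermitian_integral hP.
      by apply: le_trans (left_end hpart (ltnW jN)) (ltW (cell_lt hpart (ltnW jN))).
    by apply: le_trans (ltW (cell_lt hpart jN)) (right_end hpart jN).
  - by move=> i iN; apply: hermitian_integral hQ;
      [exact: (left_end hpart iN)|exact: (right_end hpart iN)].
  - by move=> i iN; case: hw => _ [/(_ i iN)[]].
have sl_count : sharp1 (sl_problem a b w AA) =
    (((N - 1) * d + \rank (row_mx B1 B2))%N%:R)%:E.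
  by apply: (sharp1_diag (D := D)) => l; rewrite same Dl.
have discrete_count := sharp1_diag Dl.
have shift : discrete_problem0 N tau AA = discrete_problem1 N tau CC.
  exact: discrete_problem_shift.
split; [|move=> l|exact: shift|split].
- by apply/seteqP; split=> l /spectrumE h; apply/spectrumE; [rewrite -same|rewrite same].
- by rewrite /multiplicity -!/(indep_sizes _ l) same.
- by rewrite sl_count discrete_count.
- by rewrite shift.
- by rewrite -shift.
Qed.
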